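(* Let $\Omega\subseteq\mathbb{R}^2$ be a bounded, polygonal, simply connected Lipschitz domain, let $m\ge1$ and $k\ge0$ be integers, and let $\mathcal{T}$ be a shape-regular triangulation of $\Omega$. Let $\tau\in L^2(\Omega;\mathbb{S}(m))$ satisfy $$(\tau,\operatorname{sym}\operatorname{Curl}\beta)_{L^2(\Omega)}=0\qquad\text{for all }\beta\in Y.$$ Then $\Pi_{X_h(\mathcal{T})}\tau\in W_h(\mathcal{T})$. Moreover, if $\mathcal{T}_\star$ is an admissible refinement of $\mathcal{T}$ and $\tau_\star\in W_h(\mathcal{T}_\star)$, then $\Pi_{X_h(\mathcal{T})}\tau_\star\in W_h(\mathcal{T})$.
   Context: Tensors: for $\ell\ge 1$, $\mathbb{X}(\ell):=\prod_{j=1}^{\ell}\mathbb{R}^2\cong\mathbb{R}^{2^\ell}$ denotes the $\ell$-tensors over $\mathbb{R}^2$ with components $A_{j_1,\dots,j_\ell}$, $(j_1,\dots,j_\ell)\in\{1,2\}^\ell$; $\mathbb{X}(0):=\mathbb{R}$. $\mathbb{S}(\ell)\subseteq\mathbb{X}(\ell)$ is the subspace of symmetric tensors (components invariant under all permutations of the indices), $\mathbb{S}(0)=\mathbb{R}$. The symmetric part of $A\in\mathbb{X}(\ell)$ is $(\operatorname{sym}A)_{j_1,\dots,j_\ell}:=\frac1{\ell!}\sum_{\pi}A_{j_{\pi(1)},\dots,j_{\pi(\ell)}}$, the sum running over all permutations $\pi$ of $\{1,\dots,\ell\}$. For tensors, $A:B:=\sum_{j_1,\dots,j_\ell}A_{j_1,\dots,j_\ell}B_{j_1,\dots,j_\ell}$,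 and $(f,g)_{L^2(\Omega)}:=\int_\Omega f:g\,dx$. $H^1(\Omega;X)$, $L^2(\Omega;X)$ denote $X$-valued functions with components in $H^1(\Omega)$, $L^2(\Omega)$. For $\sigma\in H^1(\Omega;\mathbb{X}(\ell))$, $\operatorname{Curl}\sigma\in L^2(\Omega;\mathbb{X}(\ell+1))$ is defined by $(\operatorname{Curl}\sigma)_{j_1,\dots,j_\ell,1}:=-\partial\sigma_{j_1,\dots,j_\ell}/\partial x_2$ and $(\operatorname{Curl}\sigma)_{j_1,\dots,j_\ell,2}:=\partial\sigma_{j_1,\dots,j_\ell}/\partial x_1$. Space $Y$: let $\mathfrak{H}(\Omega,m-1):=\{v\in H^1(\Omega;\mathbb{S}(m-1)):\int_\Omega v\,dx=0\}$, $Z:=\{\beta\in\mathfrak{H}(\Omega,m-1):\operatorname{sym}\operatorname{Curl}\beta=0\}$, and $Y:=\{\gamma\in\mathfrak{H}(\Omega,m-1):(\operatorname{Curl}\beta,\operatorname{Curl}\gamma)_{L^2(\Omega)}=0\text{ for all }\beta\in Z\}$. Triangulations and discrete spaces: a triangulation $\mathcal{T}$ of $\Omega$ is a finite set of closed triangles covering $\overline\Omega$ such that any two distinct triangles are either disjoint or share exactly one common edge or one vertex. An admissible refinement of $\mathcal{T}$ is a triangulation of $\Omega$ created from $\mathcal{T}$ by newest-vertex bisection; in particular each of its triangles is contained in a triangle of $\mathcal{T}$. $P_k(\mathcal{T};X)$ denotes the functions $\Omega\to X$ whose restriction to each $T\in\mathcal{T}$ has components that are polynomials of total degree $\le k$.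 Set $X_h(\mathcal{T}):=P_k(\mathcal{T};\mathbb{S}(m))$, $Y_h(\mathcal{T}):=P_{k+1}(\mathcal{T};\mathbb{X}(m-1))\cap Y$, and $$W_h(\mathcal{T}):=\{\tau_h\in X_h(\mathcal{T}):(\tau_h,\operatorname{sym}\operatorname{Curl}\beta_h)_{L^2(\Omega)}=0\text{ for all }\beta_h\in Y_h(\mathcal{T})\}.$$ $\Pi_{X_h(\mathcal{T})}$ denotes the $L^2$-orthogonal projection of $L^2(\Omega;\mathbb{X}(m))$ onto $X_h(\mathcal{T})$. *)

(* Defs.v *)
From Stdlib Require Import Relation_Operators.
From HB Require Import structures.
From mathcomp Require Import all_boot all_order all_algebra all_fingroup.
From mathcomp Require Import all_classical all_reals all_analysis.
Set Implicit Arguments.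
Unset Strict Implicit.
Unset Printing Implicit Defensive.
Import Order.TTheory GRing.Theory Num.Theory.
Import numFieldNormedType.Exports.
Local Open Scope classical_set_scope.
Local Open Scope ring_scope.

(** The plane carries the product (sup) norm and topology.  [measurableTypeR R]
    is [R] with its Borel sets; measurability below is therefore Borel, and not
    invariant under modification on a null set. *)
Notation plane R := (measurableTypeR R * measurableTypeR R)%type.
Notation mu2 R := (@lebesgue_measure R \x @lebesgue_measure R)%E.

Section Domains.
Context {R : realType}.
Implicit Types (Omega : set (plane R)) (a b x y : plane R).

Definition segment a b : set (plane R) :=
  [set x | exists2 s : R, 0 <= s <= 1 & x = (1 - s) *: a + s *: b].

Definition dist2 x y : R := Num.sqrt ((x.1 - y.1) ^+ 2 + (x.2 - y.2) ^+ 2).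

Definition boundary Omega : set (plane R) := closure Omega `\` interior Omega.

Definition polygonal Omega :=
  exists2 S : set (plane R * plane R), finite_set S &
    boundary Omega = \bigcup_(s in S) segment s.1 s.2.

(** Every loop is null-homotopic with fixed base point.  Path-connectedness is
    not repeated: for open sets it follows from connectedness. *)
Definition simply_connected Omega :=
  forall c : R -> plane R,
    {within `[0, 1], continuous c} -> c 0 = c 1 -> c @` `[0, 1] `<=` Omega ->
    exists H : R * R -> plane R,
      [/\ {within `[0, 1] `*` `[0, 1], continuous H},
          H @` (`[0, 1] `*` `[0, 1]) `<=` Omega,
          (forall t, t \in `[0, 1] -> H (0, t) = c t),
          (forall t, t \in `[0, 1] -> H (1, t) = c 0) &
          (forall s, s \in `[0, 1] -> H (s, 0) = c 0 /\ H (s, 1) = c 0)].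

(** Near each boundary point, in Cartesian coordinates centred at that point
    with first axis along the unit vector [u], the set is the strict epigraph of
    a Lipschitz function. *)
Definition lipschitz_boundary Omega :=
  forall x0, boundary Omega x0 ->
  exists (u : plane R) (h : R -> R) (r : R),
    [/\ u.1 ^+ 2 + u.2 ^+ 2 = 1, lipschitz h, 0 < r &
        forall x, ball x0 r x ->
          (Omega x <->
           h (u.1 * (x.1 - x0.1) + u.2 * (x.2 - x0.2)) <
           u.1 * (x.2 - x0.2) - u.2 * (x.1 - x0.1))].

Definition domain Omega := [/\ open Omega, connected Omega & Omega !=set0].

Definition polygonal_lipschitz_domain Omega :=
  [/\ domain Omega /\ bounded_set Omega, polygonal Omega,
      simply_connected Omega & lipschitz_boundary Omega].

End Domains.

(** The indices [1, 2] of the mathematics are [ord0, ord_max : 'I_2]. *)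
Definition mindex (l : nat) := {ffun 'I_l -> 'I_2}.
Notation tensor R l := {ffun mindex l -> R}.
Notation tfield R l := (plane R -> tensor R l).

Section Tensors.
Context {R : realType}.

Definition tdot l (A B : tensor R l) : R := \sum_j A j * B j.

Definition perm_index l (s : 'S_l) (j : mindex l) : mindex l :=
  [ffun i => j (s i)].

Definition symmetric l (A : tensor R l) :=
  forall (s : 'S_l) j, A (perm_index s j) = A j.

Definition sym l (A : tensor R l) : tensor R l :=
  [ffun j => (l`!%:R)^-1 * \sum_(s : 'S_l) A (perm_index s j)].

Definition init_index l (j : mindex l.+1) : mindex l :=
  [ffun i => j (lift ord_max i)].
Definition last_index l (j : mindex l.+1) : 'I_2 := j ord_max.

End Tensors.

(** Elements of function spaces on [Omega] are represented by functions on the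
    whole plane, of which only the values on [Omega] matter. *)

Section Sobolev.
Context {R : realType}.
Variable Omega : set (plane R).

Definition L2 : set (plane R -> R) :=
  [set f | f \_ Omega \in Lfun (mu2 R) 2%:E].

Definition basis_vec (i : 'I_2) : plane R :=
  if i == ord0 then (1, 0) else (0, 1).

Definition pderiv (i : 'I_2) (f : plane R -> R) : plane R -> R :=
  fun x => 'D_(basis_vec i) f x.

(** Differentiability of all iterated partial derivatives makes them all
    continuous, so this is C^infinity. *)
Definition smooth (f : plane R -> R) :=
  forall (s : seq 'I_2) x, differentiable (foldr pderiv f s) x.

Definition test_function (phi : plane R -> R) :=
  smooth phi /\
  exists K, [/\ compact K, K `<=` Omega & forall x, ~ K x -> phi x = 0].

Definition weak_pderiv (i : 'I_2) (f g : plane R -> R) :=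
  forall phi, test_function phi ->
    \int[mu2 R]_(x in Omega) (f x * pderiv i phi x) =
    - \int[mu2 R]_(x in Omega) (g x * phi x).

Definition H1 : set (plane R -> R) :=
  [set f | L2 f /\ forall i, exists2 g, L2 g & weak_pderiv i f g].

(** Meaningful for [f] in [H1] only; unique up to null sets there. *)
Definition wpderiv (i : 'I_2) (f : plane R -> R) : plane R -> R :=
  xget (fun=> 0) [set g | L2 g /\ weak_pderiv i f g].

Definition L2t l : set (tfield R l) :=
  [set f | forall j, L2 (fun x => f x j)].

Definition H1t l : set (tfield R l) :=
  [set f | forall j, H1 (fun x => f x j)].

Definition sym_valued l (f : tfield R l) :=
  {ae mu2 R, forall x, Omega x -> symmetric (f x)}.

Definition L2dot l (f g : tfield R l) : R :=
  \int[mu2 R]_(x in Omega) tdot (f x) (g x).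

Definition Curl l (f : tfield R l) : tfield R l.+1 :=
  fun x => [ffun j : mindex l.+1 =>
    let fj := fun y => f y (init_index j) in
    if last_index j == ord0 then - wpderiv ord_max fj x else wpderiv ord0 fj x].

Definition symCurl l (f : tfield R l) : tfield R l.+1 := fun x => sym (Curl f x).

Definition frakH l : set (tfield R l) :=
  [set v | [/\ H1t v, sym_valued v &
               forall j, \int[mu2 R]_(x in Omega) v x j = 0]].

Definition Zspace l : set (tfield R l) :=
  [set b | frakH b /\ {ae mu2 R, forall x, Omega x -> symCurl b x = 0}].

Definition Yspace l : set (tfield R l) :=
  [set g | frakH g /\ forall b, Zspace b -> L2dot (Curl b) (Curl g) = 0].

(** L2-orthogonal projection of [f] onto [V].  The default value [f] is
    irrelevant when the projection exists, e.g. for finite-dimensional [V]. *)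
Definition L2proj l (V : set (tfield R l)) (f : tfield R l) : tfield R l :=
  xget f [set p | V p /\ forall q, V q -> L2dot (fun x => f x - p x) q = 0].

End Sobolev.

(** A triangle comes with its newest vertex [apex]; the edge from [base1] to
    [base2] is the refinement edge. *)
Record triangle (R : realType) := Triangle {
  apex : plane R; base1 : plane R; base2 : plane R }.

Section Triangulations.
Context {R : realType}.
Implicit Types (t : triangle R) (T : set (triangle R)).

Definition vertices t : set (plane R) := [set apex t; base1 t; base2 t].

Definition nondegenerate t :=
  (((base1 t).1 - (apex t).1) * ((base2 t).2 - (apex t).2)
   - ((base1 t).2 - (apex t).2) * ((base2 t).1 - (apex t).1)) != 0.

Definition hull t : set (plane R) :=
  [set x | exists a b c : R, [/\ 0 <= a, 0 <= b, 0 <= c, a + b + c = 1 &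
     x = a *: apex t + b *: base1 t + c *: base2 t]].

Definition conforming t1 t2 :=
  [\/ hull t1 `&` hull t2 = set0,
      (exists a b, [/\ a <> b, [set a; b] `<=` vertices t1 `&` vertices t2 &
                       hull t1 `&` hull t2 = segment a b]) |
      exists a, (vertices t1 `&` vertices t2) a /\
                hull t1 `&` hull t2 = [set a]].

(** Since [conforming] excludes equal hulls, a triangulation contains each
    closed triangle with one choice of newest vertex only. *)
Definition triangulation (Omega : set (plane R)) T :=
  [/\ finite_set T, (forall t, T t -> nondegenerate t),
      \bigcup_(t in T) hull t = closure Omega &
      forall t1 t2, T t1 -> T t2 -> t1 <> t2 -> conforming t1 t2].

(** The ratio of diameter to inradius is bounded by [kappa]. *)
Definition shape_regular (kappa : R) T :=
  forall t, T t -> exists (z : plane R) (rho : R),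
    [/\ 0 < rho, [set x | dist2 x z <= rho] `<=` hull t &
        forall x y, hull t x -> hull t y -> dist2 x y <= kappa * rho].

Definition midpoint t : plane R := 2^-1 *: (base1 t + base2 t).

Definition bisection T T' :=
  exists2 t, T t &
    T' = (T `\ t) `|` [set Triangle (midpoint t) (apex t) (base1 t);
                           Triangle (midpoint t) (apex t) (base2 t)].

Definition admissible_refinement (Omega : set (plane R)) T T' :=
  clos_refl_trans _ bisection T T' /\ triangulation Omega T'.

End Triangulations.

Section Discrete.
Context {R : realType}.
Variable Omega : set (plane R).
Implicit Types T : set (triangle R).

Definition poly_le (k : nat) : set (plane R -> R) :=
  [set p | exists c : nat -> nat -> R, forall x,
     p x = \sum_(i < k.+1) \sum_(j < k.+1 | (i + j <= k)%N)
             c i j * x.1 ^+ i * x.2 ^+ j].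

(** Piecewise polynomials are taken as elements of L2, i.e. up to null sets, as
    two closed triangles may share an edge; membership in [L2t] only adds Borel
    measurability of the representative. *)
Definition Pk (k : nat) T l : set (tfield R l) :=
  [set f | L2t Omega f /\
     forall t, T t -> forall j, exists2 p, poly_le k p &
       {ae mu2 R, forall x, Omega x -> hull t x -> f x j = p x}].

Definition Xh (k m : nat) T : set (tfield R m) :=
  [set f | Pk k T f /\ sym_valued Omega f].

(** [Yh k l T] and [Wh k l T] are the spaces for tensor order [m = l.+1]. *)
Definition Yh (k l : nat) T : set (tfield R l) :=
  Pk k.+1 T (l:=l) `&` Yspace Omega (l:=l).

Definition Wh (k l : nat) T : set (tfield R l.+1) :=
  [set f | Xh k T f /\
     forall b, Yh k T b -> L2dot Omega f (symCurl Omega b) = 0].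

End Discrete.

(* Main.v *)
(** The Curl of a piecewise polynomial field of degree [k+1] in H^1 is piecewise
    polynomial of degree [k], so [sym Curl] maps [Y_h] into [X_h].  Hence
    [(Pi tau, sym Curl b) = (tau, sym Curl b)] for every [b] in [Y_h], and the
    right-hand side vanishes as [Y_h] is a subspace of [Y].  For a refinement it
    vanishes because [Y_h(T)] is a subspace of [Y_h(T_star)], every triangle of
    [T_star] being contained in a triangle of [T].

    That the weak derivatives of such a field are the elementwise classical ones
    is the analytic part.  The weak derivative minus the classical one is
    integrated against products of the functions [t |-> exp(-1/t)], composed with
    affine maps and supported in a rectangle inside the triangle; these increase
    to the indicator of the rectangle, and rectangles determine an integrable
    function almost everywhere. *)
Require Import Defs.
From HB Require Import structures.
From mathcomp Require Import all_boot all_order all_algebra all_fingroup.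
From mathcomp Require Import ring lra.
From mathcomp Require Import all_classical all_reals all_analysis measurable_realfun.
Set Implicit Arguments.
Unset Strict Implicit.
Unset Printing Implicit Defensive.
Import Order.TTheory GRing.Theory Num.Theory.
Import numFieldNormedType.Exports.
Local Open Scope classical_set_scope.
Local Open Scope ring_scope.

(** * Orthogonal projection for a positive semidefinite form *)

Section Projection.
Context {R : realFieldType} {E : lmodType R}.

Definition is_subspace (V : set E) :=
  V 0 /\ forall a x y, V x -> V y -> V (a *: x + y).

Lemma subspaceZ V a x : is_subspace V -> V x -> V (a *: x).
Proof. by move=> [V0 VD] Vx; rewrite -[a *: x]addr0; apply: VD. Qed.

Lemma subspaceD V x y : is_subspace V -> V x -> V y -> V (x + y).
Proof. by move=> [V0 VD] Vx Vy; rewrite -[x]scale1r; apply: VD. Qed.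

Lemma subspaceB V x y : is_subspace V -> V x -> V y -> V (x - y).
Proof.
by move=> sV Vx Vy; rewrite addrC -scaleN1r; apply: sV.2.
Qed.

Lemma subspace_sum V (I : finType) (F : I -> E) :
  is_subspace V -> (forall i, V (F i)) -> V (\sum_i F i).
Proof.
move=> sV VF; elim/big_ind: _ => //; first exact: sV.1.
by move=> x y; exact: subspaceD.
Qed.

(** Linearity is confined to [L]: in the application [B] is the L2 product, and integrals of fields
    outside L2 need not be additive. *)
Variables (L : set E) (B : E -> E -> R).
Hypothesis sL : is_subspace L.
Hypothesis BC : forall x y, B x y = B y x.
Hypothesis Bl : forall a x y z, L x -> L y -> L z ->
  B (a *: x + y) z = a * B x z + B y z.
Hypothesis Bge0 : forall x, L x -> 0 <= B x x.

Let B0 z : L z -> B 0 z = 0.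
Proof.
by move=> Lz; have := Bl 0 Lz Lz Lz; rewrite mul0r scale0r !add0r => /eqP;
  have := Bl (-1) Lz Lz Lz; rewrite scaleN1r addNr mulN1r addNr.
Qed.

Let Br a x y z : L x -> L y -> L z -> B z (a *: x + y) = a * B z x + B z y.
Proof. by move=> *; rewrite BC Bl// (BC z x) (BC z y). Qed.

Let Bsum (I : finType) (a : I -> R) (F : I -> E) z : L z ->
  (forall i, L (F i)) -> (forall i, B z (F i) = 0) ->
  B z (\sum_i a i *: F i) = 0.
Proof.
move=> Lz LF BF.
suff [] : L (\sum_i a i *: F i) /\ B z (\sum_i a i *: F i) = 0 by [].
elim/big_ind: _ => //.
- by split; [exact: sL.1|rewrite BC B0].
- move=> x y [Lx Bx] [Ly By]; split; first exact: subspaceD.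
  by rewrite -[x]scale1r Br// Bx By mulr0 addr0.
- move=> i _; split; first exact: subspaceZ.
  by rewrite -[_ *: _]addr0 Br ?BF ?(BC z 0) ?B0 ?mulr0 ?addr0//; exact: sL.1.
Qed.

(** When [e] is isotropic, [B (t *: e + g) (t *: e + g)] is affine in [t] with slope [2 * B e g]. An
    affine function bounded below is constant; the [t] chosen here would give it the value [-1]. *)
Lemma isotropic_orthogonal e g : L e -> L g -> B e e = 0 -> B e g = 0.
Proof.
move=> Le Lg ee; apply/eqP; apply: contraT => eg0.
pose G := B g g; pose t := - (G + 1) / (2 * B e g).
have Lteg : L (t *: e + g) by exact: sL.2.
have := Bge0 Lteg; rewrite Bl// Br// Br// ee (BC g e) -/G.
rewrite mulr0 add0r addrA.
have -> : t * B e g + t * B e g + G = -1.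
  by rewrite /t; field; rewrite eg0.
by move=> ?; lra.
Qed.

Let orthogonal f := [set q | L q /\ B f q = 0].

Let subspace_orthogonal f : L f -> is_subspace (orthogonal f).
Proof.
move=> Lf; split; first by split; [exact: sL.1|rewrite BC B0].
move=> a x y [Lx fx] [Ly fy]; split; first exact: sL.2.
by rewrite Br// fx fy mulr0 addr0.
Qed.

(** Gram-Schmidt by induction on [s]. That [p] lies in the span of [s] is expressed by membership in
    every subspace containing [s]. *)
Lemma orthogonal_projection_seq (s : seq E) : (forall q, q \in s -> L q) ->
  forall f, L f -> exists p,
    (forall V, is_subspace V -> (forall q, q \in s -> V q) -> V p) /\
    forall q, q \in s -> B (f - p) q = 0.
Proof.
elim: s => [|e s IH] Ls f Lf.
  by exists 0; split => // V [].
have Ls' q : q \in s -> L q by move=> qs; apply: Ls; rewrite inE qs orbT.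
have Le : L e by apply: Ls; rewrite mem_head.
have [p [pV pP]] := IH Ls' f Lf; have [r [rV rP]] := IH Ls' e Le.
have Lr : L r by exact: rV.
have Lfp : L (f - p) by apply: subspaceB => //; exact: pV.
(* [e'] is the part of [e] orthogonal to the tail [s], and [a] is the coefficient of [f - p] along
   it. *)
pose e' := e - r; pose a := B (f - p) e' / B e' e'.
have Le' : L e' by exact: subspaceB.
exists (a *: e' + p); split => [V sV Vs|q].
  have Vs' q : q \in s -> V q by move=> qs; apply: Vs; rewrite inE qs orbT.
  apply: sV.2; last exact: pV.
  by apply: subspaceB => //; [apply: Vs; rewrite mem_head|exact: rV].
have -> : f - (a *: e' + p) = (- a) *: e' + (f - p).
  by rewrite opprD addrCA scaleNr.
have fq q' : q' \in s -> B (- a *: e' + (f - p)) q' = 0.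
  by move=> q's; rewrite Bl ?rP ?pP ?mulr0 ?addr0//; exact: Ls'.
rewrite inE => /predU1P[->|/fq//].
have fe' : B (- a *: e' + (f - p)) e' = 0.
  (* If [e'] is isotropic, then [a] is a division by zero; but [e'] is then orthogonal to all of
     [L], so any coefficient works. *)
  rewrite Bl// /a; have [e0|e0] := eqVneq (B e' e') 0; last by field.
  by rewrite (BC _ e') (isotropic_orthogonal (g := f - p))// e0 !mulr0 addr0.
have Lf' : L (- a *: e' + (f - p)) by exact: sL.2.
(* The orthogonal complement of the residual is a subspace containing [s], hence it contains [r]. *)
have [_ fr] : orthogonal (- a *: e' + (f - p)) r.
  apply: rV; first exact: subspace_orthogonal.
  by move=> q' q's; split; [exact: Ls'|exact: fq].
have -> : e = 1 *: e' + r by rewrite scale1r subrK.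
by rewrite Br// fe' fr mulr0 addr0.
Qed.

(* [V] need not be finite-dimensional, only its quotient by the isotropic
   vectors: [rel] linearly assigns coordinates in [C], and the vectors with zero
   coordinates are orthogonal to everything. *)
Lemma orthogonal_projection (C : vectType R) (rel : E -> C -> Prop) (V : set E) :
  is_subspace V -> V `<=` L ->
  rel 0 0 ->
  (forall a x y c d, rel x c -> rel y d -> rel (a *: x + y) (a *: c + d)) ->
  (forall x, V x -> exists c, rel x c) ->
  (forall x y, V x -> rel x 0 -> L y -> B y x = 0) ->
  forall f, L f -> exists p, V p /\ forall q, V q -> B (f - p) q = 0.
Proof.
move=> sV VL rel0 relD relV rel_null f Lf.
(* [U] is good if each of its vectors is the coordinate vector of some element of [V]. A good [U] of
   maximal dimension serves as the coordinate space of [V]. *)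
pose good (U : {vspace C}) := forall c, c \in U -> exists2 x, V x & rel x c.
pose dims n := `[< exists2 U, good U & \dim U = n >].
have dims0 : exists n, dims n.
  exists 0; apply/asboolP; exists 0%VS; last exact: dimv0.
  by move=> c; rewrite memv0 => /eqP ->; exists 0 => //; exact: sV.1.
have dims_le n : dims n -> (n <= dim C)%N.
  by move=> /asboolP[U _ <-]; rewrite -dimvf; exact/dimvS/subvf.
case: (ex_maxnP dims0 dims_le) => n /asboolP[U gU dU] nmax.
(* Otherwise adjoining [c] to [U] would give a larger good space. *)
have inU c x : V x -> rel x c -> c \in U.
  move=> Vx xc; have gUc : good (U + <[c]>)%VS.
    move=> d /memv_addP[u /gU[y Vy yu]] [w /vlineP[a ->] ->].
    exists (a *: x + y); first exact: sV.2.
    by rewrite [u + _]addrC; exact: relD.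
  suff : (U + <[c]> <= U)%VS by rewrite subv_add memvE => /andP[].
  rewrite -(geq_leqif (dimv_leqif_sup (addvSl U <[c]>))) dU; apply: nmax.
  by apply/asboolP; exists (U + <[c]>)%VS.
have /choice[F FP] : forall i : 'I_(\dim U), exists x, V x /\ rel x (vbasis U)`_i.
  move=> i; have [|x Vx xi] := gU (vbasis U)`_i; last by exists x.
  by apply: vbasis_mem; apply: mem_nth; rewrite size_tuple.
have LF i : L (F i) by apply/VL; have [] := FP i.
have [|p [pV pP]] := @orthogonal_projection_seq (codom F) _ f Lf.
  by move=> q /codomP[i ->].
exists p; split; first by apply: pV => // q /codomP[i ->]; have [] := FP i.
move=> q Vq; have [c qc] := relV q Vq; have cU := inU _ _ Vq qc.
have Lfp : L (f - p).
  by apply: subspaceB => //; apply: pV => // ? /codomP[i ->].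
(* [q'] is a combination of the lifted basis with the same coordinates as [q], so [q - q'] has zero
   coordinates and is orthogonal to everything. *)
pose q' := \sum_i coord (vbasis U) i c *: F i.
have Vq' : V q'.
  by apply: subspace_sum => // i; apply: subspaceZ => //; have [] := FP i.
have rel_q' : rel q' c.
  rewrite (coord_vbasis cU) /q'; elim/big_ind2 : _ => //.
  - by move=> x1 x2 y1 y2 h1 h2; rewrite -[x1]scale1r -[x2]scale1r; exact: relD.
  - move=> i _; rewrite -[X in rel X _]addr0 -[X in rel _ X]addr0.
    by apply: relD => //; have [] := FP i.
have -> : q = q' + (q - q') by rewrite addrC subrK.
rewrite -{1}[q']scale1r Br//; [|exact: VL|by apply: VL; exact: subspaceB].
rewrite Bsum//; last by move=> i; apply: pP; exact: codom_f.
have rel_diff : rel (q - q') 0.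
  have -> : 0 = (-1) *: c + c by rewrite scaleN1r addNr.
  by rewrite addrC -scaleN1r; exact: relD.
by rewrite rel_null// ?mulr0 ?addr0//; exact: subspaceB.
Qed.

End Projection.

(** * Square-integrable fields *)

Section L2Algebra.
Context {R : realType}.
Variable Omega : set (plane R).
Local Notation mu := (mu2 R).

Lemma L2_linear a (f g : plane R -> R) :
  L2 Omega f -> L2 Omega g -> L2 Omega (fun x => a * f x + g x).
Proof.
rewrite /L2/= => Lf Lg.
have -> : (fun x => a * f x + g x) \_ Omega =
    (a \o* (f \_ Omega)) + g \_ Omega :> (plane R -> R).
  apply/funext => x; rewrite /GRing.add/= /patch; case: ifP => _.
    by rewrite mulrC.
  by rewrite mul0r addr0.
apply: (Lfun_addr_closed mu _).2 => //; first by rewrite lee_fin ler1n.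
by apply: Lfun_scale; rewrite ?ler1n.
Qed.

Lemma L2_cst0 : L2 Omega (fun=> 0).
Proof.
rewrite /L2/=; have -> : (fun=> 0) \_ Omega = 0 :> (plane R -> R).
  by apply/funext => x; rewrite /patch; case: ifP.
apply: (Lfun_addr_closed mu _).1.
by rewrite lee_fin ler1n.
Qed.

Lemma L2_measurable f : L2 Omega f -> measurable_fun setT (f \_ Omega).
Proof. by move=> /andP[]; rewrite inE. Qed.

Lemma L2M_integrable f g : L2 Omega f -> L2 Omega g ->
  mu.-integrable setT (EFin \o ((f \* g) \_ Omega)).
Proof.
move=> Lf Lg; apply/Lfun1_integrable.
have -> : (f \* g) \_ Omega = (f \_ Omega) \* (g \_ Omega).
  by apply/funext => x /=; rewrite /patch; case: ifP => _ //; rewrite mulr0.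
exact: Lfun2_mul_Lfun1.
Qed.

Context {l : nat}.
Implicit Types f g h : tfield R l.

Lemma is_subspace_L2t : is_subspace (@L2t R Omega l).
Proof.
split=> [j|a x y Lx Ly j].
  by under [X in L2 _ X]funext do rewrite ffunE; exact: L2_cst0.
suff <- : (fun z => a * x z j + y z j) = (fun z => (a *: x + y) z j).
  exact: L2_linear (Lx j) (Ly j).
by apply/funext => z; rewrite !ffunE.
Qed.

Lemma tdot_integrable f g : L2t Omega f -> L2t Omega g ->
  mu.-integrable setT (EFin \o ((fun x => tdot (f x) (g x)) \_ Omega)).
Proof.
move=> Lf Lg.
have -> : EFin \o ((fun x => tdot (f x) (g x)) \_ Omega) = (fun x => \sum_j
    (((fun x => f x j) \* (fun x => g x j)) \_ Omega x)%:E)%E.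
  apply/funext => x /=; rewrite sumEFin; congr EFin.
  by rewrite /patch; case: ifP => // _; rewrite big1.
apply: integrable_sum => // j _; exact: (L2M_integrable (Lf j) (Lg j)).
Qed.

Lemma L2dot_linear a f g h : L2t Omega f -> L2t Omega g -> L2t Omega h ->
  L2dot Omega (a *: f + g) h = a * L2dot Omega f h + L2dot Omega g h.
Proof.
move=> Lf Lg Lh; rewrite /L2dot !(Rintegral_mkcond _ Omega).
rewrite -RintegralZl//; last exact: tdot_integrable.
rewrite -RintegralD//; last exact: tdot_integrable; last first.
  exact: (integrableZl measurableT a (tdot_integrable Lf Lh)).
apply: eq_Rintegral => x _; rewrite /patch; case: ifP => _; last by rewrite mulr0 addr0.
rewrite /tdot mulr_sumr -big_split/=; apply: eq_bigr => j _.
by rewrite !ffunE mulrDl mulrA.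
Qed.

Lemma L2dotC f g : L2dot Omega f g = L2dot Omega g f.
Proof.
apply: eq_Rintegral => x _; apply: eq_bigr => j _; exact: mulrC.
Qed.

Lemma L2dot_ge0 f : 0 <= L2dot Omega f f.
Proof.
by apply: Rintegral_ge0 => x _; apply: sumr_ge0 => j _; rewrite -expr2 sqr_ge0.
Qed.

Lemma L2dot_null f g : L2t Omega f -> L2t Omega g ->
  {ae mu, forall x, Omega x -> g x = 0} -> L2dot Omega f g = 0.
Proof.
move=> Lf Lg g0; rewrite /L2dot Rintegral_mkcond /Rintegral.
rewrite (@ae_eq_integral _ _ _ mu setT (cst 0%E) (EFin \o _))//.
- by rewrite integral0.
- exact: measurable_int (tdot_integrable Lf Lg).
- apply: filterS g0 => x gx _ /=; rewrite /patch; case: ifPn => //.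
  move=> /set_mem/gx gx0; rewrite /tdot big1// => j _.
  by rewrite gx0 ffunE mulr0.
Qed.

End L2Algebra.

Lemma finite_set_range (X : Type) (A : set X) : finite_set A ->
  exists n (g : 'I_n -> X), range g = A.
Proof.
move=> [n /card_set_bijP[f [fA finj fsurj]]].
have /choice[g gP] : forall i : 'I_n, exists x, A x /\ f x = i.
  by move=> i; have [x Ax <-] := fsurj i (ltn_ord i); exists x.
exists n, g; apply/seteqP; split => [_ [i _ <-]|x Ax]; first by have [] := gP i.
exists (Ordinal (fA x Ax)) => //.
by apply: finj; rewrite ?inE; have [] := gP (Ordinal (fA x Ax)).
Qed.

(** * Existence of the projection onto piecewise polynomials *)

Section PiecewisePolynomials.
Context {R : realType}.
Variable Omega : set (plane R).
Local Notation mu := (mu2 R).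

Lemma poly_le_linear k a (p q : plane R -> R) :
  poly_le k p -> poly_le k q -> poly_le k (fun x => a * p x + q x).
Proof.
move=> [c cE] [d dE]; exists (fun i j => a * c i j + d i j) => x.
rewrite cE dE mulr_sumr -big_split/=; apply: eq_bigr => i _.
rewrite mulr_sumr -big_split/=; apply: eq_bigr => j _; ring.
Qed.

Lemma poly_le0 k : poly_le k (fun=> 0 : R).
Proof.
exists (fun _ _ => 0) => x; rewrite big1// => i _; rewrite big1// => j _.
by rewrite !mul0r.
Qed.

Context {l : nat}.

Lemma symmetric_linear a (A B : tensor R l) :
  Defs.symmetric A -> Defs.symmetric B -> Defs.symmetric (a *: A + B).
Proof. by move=> sA sB s j; rewrite !ffunE sA sB. Qed.

Lemma is_subspace_Xh k T : is_subspace (@Xh R Omega k l T).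
Proof.
split.
  split; last by apply: aeW => x _ s j; rewrite !ffunE.
  split; first exact: (is_subspace_L2t Omega).1.
  move=> t Tt j; exists (fun=> 0); first exact: poly_le0.
  by apply: aeW => x _ _; rewrite ffunE.
move=> a f g [[Lf Pf] Sf] [[Lg Pg] Sg]; split.
  split; first exact: (is_subspace_L2t Omega).2.
  move=> t Tt j; have [p p_le fp] := Pf t Tt j; have [q q_le gq] := Pg t Tt j.
  exists (fun x => a * p x + q x); first exact: poly_le_linear.
  apply: filterS2 fp gq => x fp gq Ox tx.
  by rewrite !ffunE fp// gq.
apply: filterS2 Sf Sg => x sf sg Ox; exact: symmetric_linear (sf Ox) (sg Ox).
Qed.

(** [L2proj] is a choice, so existence has to be shown. Up to null sets a piecewise polynomial field
    is given by finitely many coefficients per triangle, which are the coordinates fed to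
    [orthogonal_projection]. *)
Lemma Xh_projection k T (f : tfield R l) :
  finite_set T -> Omega `<=` \bigcup_(t in T) hull t -> L2t Omega f ->
  Xh Omega k T (L2proj Omega (Xh Omega k T) f) /\
  forall q, Xh Omega k T q ->
    L2dot Omega (fun x => f x - L2proj Omega (Xh Omega k T) f x) q = 0.
Proof.
move=> /finite_set_range[n [g gT]] OT Lf.
suff /xgetPex : exists p, [set p | Xh Omega k T p /\ forall q, Xh Omega k T q ->
  L2dot Omega (fun x => f x - p x) q = 0] p by exact.
have Tg i : T (g i) by rewrite -gT; exists i.
pose I := ('I_n * mindex l * ('I_k.+1 * 'I_k.+1))%type.
pose pol (c : {ffun I -> R^o}) i j (x : plane R) : R :=
  \sum_(a < k.+1) \sum_(b < k.+1 | (a + b <= k)%N)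
    (c (i, j, (a, b)) : R) * x.1 ^+ a * x.2 ^+ b.
(* A relation and not a function: on a triangle meeting [Omega] in a null set, every choice of
   coefficients fits. *)
pose rel (q : tfield R l) c := forall i j,
  {ae mu, forall x, Omega x -> hull (g i) x -> q x j = pol c i j x}.
apply: (orthogonal_projection (is_subspace_L2t Omega) (@L2dotC _ _ _)
  (@L2dot_linear _ Omega l) (fun x _ => L2dot_ge0 Omega x) (rel := rel)) => //.
- exact: is_subspace_Xh.
- by move=> q [[]].
- move=> i j; apply: aeW => x _ _; rewrite /pol ffunE big1// => a _.
  by rewrite big1// => b _; rewrite ffunE !mul0r.
- move=> a x y c d xc yd i j.
  apply: filterS2 (xc i j) (yd i j) => z xz yz Oz gz.
  rewrite !ffunE xz// yz// /pol -[_ *: _]/(_ * _) mulr_sumr -big_split/=.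
  apply: eq_bigr => u _.
  rewrite mulr_sumr -big_split/=; apply: eq_bigr => v _.
  by rewrite !ffunE/=; rewrite !mulrDl !mulrA.
- move=> q [[_ Pq] _].
  have /choice[c cP] : forall ij : 'I_n * mindex l, exists c : nat -> nat -> R,
      {ae mu, forall x, Omega x -> hull (g ij.1) x ->
       q x ij.2 = \sum_(a < k.+1) \sum_(b < k.+1 | (a + b <= k)%N)
         c a b * x.1 ^+ a * x.2 ^+ b}.
    move=> [i j]/=; have [p [c pE] qp] := Pq _ (Tg i) j; exists c.
    by apply: filterS qp => x; rewrite pE.
  exists [ffun u : I => c u.1 u.2.1 u.2.2] => i j.
  apply: filterS (cP (i, j)) => x /[apply]/[apply]/= ->.
  by apply: eq_bigr => a _; apply: eq_bigr => b _; rewrite ffunE.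
(* Zero coefficients on all triangles make [q] vanish almost everywhere, since the triangles cover
   [Omega]. *)
move=> q p [[Lq _] _] q0 Lp; apply: L2dot_null => //.
have : {ae mu, forall x, forall ij : 'I_n * mindex l,
    Omega x -> hull (g ij.1) x -> q x ij.2 = pol 0 ij.1 ij.2 x}.
  by apply: filter_forall => -[i j]; exact: q0.
apply: filterS => x qx Ox; apply/ffunP => j; rewrite ffunE.
have [t Tt tx] := OT x Ox; move: Tt; rewrite -gT => -[i _ it].
rewrite (qx (i, j))//= ?it// /pol big1// => a _; rewrite big1// => b _.
by rewrite ffunE !mul0r.
Qed.

End PiecewisePolynomials.

(** * Smooth functions with compact support *)

Section FlatExponential.
Context {R : realType}.
Implicit Types (p : {poly R}) (t y : R).

(* The functions [p(1/t) exp(-1/t)] are closed under differentiation, and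
   vanish to infinite order at [0]. *)
Definition flat_exp p t : R := if 0 < t then p.[t^-1] * expR (- t^-1) else 0.

(** A single term of the exponential series is at most [expR y]. *)
Lemma exprn_expRN_le n y : 0 <= y -> y ^+ n * expR (- y) <= n`!%:R.
Proof.
move=> y0; rewrite expRN ler_pdivrMr ?expR_gt0//.
case: n => [|n]; first by rewrite expr0 fact0 mul1r -expR0 ler_expR.
have n0 : 0 < n.+1`!%:R :> R by rewrite ltr0n fact_gt0.
rewrite mulrC -ler_pdivrMr//; apply: le_trans (expR_ge1Dxn n y0).
by rewrite lerDr.
Qed.

Lemma horner_expRN_bounded p :
  exists C : R, forall y, 0 <= y -> `|p.[y] * expR (- y)| <= C.
Proof.
exists (\sum_(i < size p) `|p`_i| * i`!%:R) => y y0.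
rewrite horner_coef mulr_suml (le_trans (ler_norm_sum _ _ _))//.
apply: ler_sum => i _; rewrite -mulrA normrM ler_wpM2l//.
by rewrite ger0_norm ?exprn_expRN_le// mulr_ge0 ?exprn_ge0// expR_ge0.
Qed.

(** Splitting off a factor [t] stays within the family. This yields both the linear decay at [0] and
    the difference quotient there. *)
Lemma flat_expE p t : flat_exp p t = flat_exp ('X * p) t * t.
Proof.
rewrite /flat_exp; case: ifPn => [t0|]; last by rewrite mul0r.
by rewrite hornerM hornerX; field; rewrite gt_eqF.
Qed.

Lemma flat_exp_cvg0 p : flat_exp p t @[t --> (0 : R)] --> (0 : R).
Proof.
have [C CP] := horner_expRN_bounded ('X * p).
have C0 : 0 <= C by apply: le_trans (CP 0 _).
have fC t : `|flat_exp p t| <= C * `|t|.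
  rewrite flat_expE normrM ler_wpM2r// /flat_exp; case: ifPn => [t0|_].
    by rewrite CP// invr_ge0 ltW.
  by rewrite normr0.
apply/cvgr0Pnorm_lt => e e0; near=> t.
(* [C + 1] replaces [C], which may be zero, so that one can divide by it. *)
rewrite (le_lt_trans (fC t))// (@le_lt_trans _ _ ((C + 1) * `|t|))//.
  by rewrite ler_wpM2r// lerDl.
rewrite mulrC -ltr_pdivlMr ?ltr_wpDl//; near: t.
exists (e / (C + 1)) => [|t]; first by rewrite /= divr_gt0// ltr_wpDl.
by rewrite /ball_/= sub0r normrN.
Unshelve. all: by end_near. Qed.

(** With [y = 1/t], the derivative of [p(y) exp(-y)] in [y] is [(p' - p)(y) exp(-y)], and the inner
    derivative is [- y^2]. *)
Lemma is_derive_flat_exp p t :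
  is_derive t 1 (flat_exp p) (flat_exp ('X^2 * (p - p^`())) t).
Proof.
have [t0|t0|->] := ltgtP t 0.
- have -> : flat_exp ('X^2 * (p - p^`())) t = 0 by rewrite /flat_exp ltNge ltW.
  apply: (near_eq_is_derive (f := cst 0)).
  near=> s; rewrite /flat_exp/= ltNge ltW//; near: s.
  exact: lt_nbhsl.
- have -> : flat_exp ('X^2 * (p - p^`())) t =
      p.[t^-1] * (expR (- t^-1) * t^-1 ^+ 2) +
      expR (- t^-1) * (- t^-1 ^+ 2 * p^`().[t^-1]).
    rewrite /flat_exp t0 !(hornerM, hornerX, hornerD, hornerN); ring.
  have dV : is_derive t 1 (@GRing.inv R) (- t^-1 ^+ 2).
    have -> : - t^-1 ^+ 2 = - t ^- 2 *: 1 by rewrite /GRing.scale/= mulr1 exprVn.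
    by apply: (is_deriveV (f := id)); rewrite gt_eqF.
  have dp := is_derive1_comp (is_derive_poly p t^-1) dV.
  have de := is_derive1_comp (is_derive_expR _) (is_deriveN dV).
  have dm := is_deriveM dp de.
  apply: (@near_eq_is_derive _ _ _ _ _ _ _ _ _ (is_derive_eq dm _)).
    near=> s; rewrite /flat_exp ifT//; near: s; exact: lt_nbhsr.
  rewrite /GRing.scale/=; ring.
(* At [0] the slope function is [flat_exp ('X * p)], continuous there with value [0]. *)
apply/is_derive1_caratheodory; exists (flat_exp ('X * p)); split.
- by move=> z; rewrite subr0 -flat_expE [flat_exp p 0]/flat_exp ltxx subr0.
- have f0 : flat_exp ('X * p) 0 = 0 by rewrite /flat_exp ltxx.
  suff : flat_exp ('X * p) t @[t --> 0] --> flat_exp ('X * p) 0 by [].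
  by rewrite f0; exact: flat_exp_cvg0.
- by rewrite /flat_exp ltxx.
Unshelve. all: by end_near. Qed.

End FlatExponential.

(** * An algebra of smooth functions closed under differentiation *)

Section FlatAlgebra.
Context {R : realType}.
Implicit Types (f g : plane R -> R) (x v : plane R).

Definition affine (a b c : R) : plane R -> R := fun x => a * x.1 + b * x.2 + c.

(** Closure under partial derivatives turns smoothness into a structural induction. The class
    contains both the polynomials and the compactly supported test functions, hence also their
    products, to which integration by parts is applied. *)
Inductive flat_algebra : (plane R -> R) -> Prop :=
| flat_affine a b c : flat_algebra (affine a b c)
| flat_flat_exp p a b c : flat_algebra (flat_exp p \o affine a b c)
| flat_add f g : flat_algebra f -> flat_algebra g -> flat_algebra (fun x => f x + g x)
| flat_mul f g : flat_algebra f -> flat_algebra g -> flat_algebra (fun x => f x * g x).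

Lemma flat_cst c : flat_algebra (fun=> c).
Proof.
suff <- : affine 0 0 c = (fun=> c) by exact: flat_affine.
by apply/funext => x; rewrite /affine !mul0r !add0r.
Qed.

Lemma is_diff_affine a b c x :
  is_diff x (affine a b c) (fun v => a * v.1 + b * v.2 : R).
Proof.
have d1 : is_diff x (fst : plane R -> R) (fst : plane R -> R).
  apply: DiffDef; first by apply: linear_differentiable => y; exact: cvg_fst.
  by rewrite diff_lin// => y; exact: cvg_fst.
have d2 : is_diff x (snd : plane R -> R) (snd : plane R -> R).
  apply: DiffDef; first by apply: linear_differentiable => y; exact: cvg_snd.
  by rewrite diff_lin// => y; exact: cvg_snd.
have d := is_diffD (is_diffD (is_diffZ a d1) (is_diffZ b d2)) (is_diff_cst c x).
by apply: (is_diff_eq d); apply/funext => v; rewrite !fctE addr0.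
Qed.

(** Both claims go through one induction, because the sum, product and chain rules for the second
    rely on the first. *)
Lemma flat_algebra_diff f : flat_algebra f ->
  (forall x, differentiable f x) /\
  forall v, flat_algebra (fun x => 'd f x v).
Proof.
elim=> {f} [a b c|p a b c|f g _ [df Df] _ [dg Dg]|f g Ff [df Df] Fg [dg Dg]].
- split=> [x|v]; first by have [] := is_diff_affine a b c x.
  suff -> : (fun x => 'd (affine a b c) x v) = (fun=> a * v.1 + b * v.2).
    exact: flat_cst.
  by apply/funext => x; have [_ ->] := is_diff_affine a b c x.
- have dF (t : R) : differentiable (flat_exp p) t.
    by apply/derivable1_diffP; have [] := is_derive_flat_exp p t.
  have da x : differentiable (affine a b c) x.
    by have [] := is_diff_affine a b c x.
  split=> [x|v]; first exact: differentiable_comp.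
  set q := 'X^2 * (p - p^`()).
  suff -> : (fun x => 'd (flat_exp p \o affine a b c) x v) =
      (fun x => (a * v.1 + b * v.2) * (flat_exp q \o affine a b c) x).
    by apply: flat_mul; [exact: flat_cst|exact: flat_flat_exp].
  apply/funext => x; rewrite diff_comp//= diff1E//.
  have [_ ->] := is_diff_affine a b c x.
  rewrite derive1E; have [_ ->] := is_derive_flat_exp p (affine a b c x).
  by [].
- split=> [x|v]; first exact: (differentiableD (df x) (dg x)).
  suff -> : (fun x => 'd (fun x => f x + g x) x v) =
      (fun x => 'd f x v + 'd g x v) by apply: flat_add.
  by apply/funext => x; exact: (congr1 (@^~ v) (diffD (df x) (dg x))).
- split=> [x|v]; first exact: (differentiableM (df x) (dg x)).
  suff -> : (fun x => 'd (fun x => f x * g x) x v) =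
      (fun x => f x * 'd g x v + g x * 'd f x v).
    by apply: flat_add; apply: flat_mul.
  by apply/funext => x; exact: (congr1 (@^~ v) (diffM (df x) (dg x))).
Qed.

Lemma flat_algebra_pderivE i f : flat_algebra f ->
  pderiv i f = fun x => 'd f x (basis_vec i).
Proof.
by move=> /flat_algebra_diff[df _]; apply/funext => x; rewrite /pderiv deriveE.
Qed.

Lemma flat_algebra_pderiv i f : flat_algebra f -> flat_algebra (pderiv i f).
Proof.
move=> Ff; rewrite flat_algebra_pderivE//.
by have [_] := flat_algebra_diff Ff; exact.
Qed.

Lemma flat_algebra_smooth f : flat_algebra f -> smooth f.
Proof.
move=> Ff s x; suff /flat_algebra_diff[] : flat_algebra (foldr pderiv f s) by [].
by elim: s => // i s; exact: flat_algebra_pderiv.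
Qed.

Lemma flat_algebra_pderivM i f g x : flat_algebra f -> flat_algebra g ->
  pderiv i (fun x => f x * g x) x = f x * pderiv i g x + g x * pderiv i f x.
Proof.
move=> Ff Fg; rewrite !flat_algebra_pderivE//; last exact: flat_mul.
have [df _] := flat_algebra_diff Ff; have [dg _] := flat_algebra_diff Fg.
exact: (congr1 (@^~ (basis_vec i)) (diffM (df x) (dg x))).
Qed.

Lemma measurable_affine a b c : measurable_fun setT (affine a b c).
Proof.
have mf : measurable_fun setT (fst : plane R -> R) by exact: measurable_fst.
have ms : measurable_fun setT (snd : plane R -> R) by exact: measurable_snd.
apply: measurable_funD => //; apply: measurable_funD; exact: measurable_funM.
Qed.

Lemma flat_algebra_measurable f : flat_algebra f -> measurable_fun setT f.
Proof.
elim=> {f} [a b c|p a b c|f g _ mf _ mg|f g _ mf _ mg].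
- exact: measurable_affine.
- apply: measurableT_comp; last exact: measurable_affine.
  apply: continuous_measurable_fun => t.
  apply/differentiable_continuous/derivable1_diffP.
  by have [] := is_derive_flat_exp p t.
- exact: measurable_funD.
- exact: measurable_funM.
Qed.

Lemma flat_algebra_continuous f : flat_algebra f -> continuous f.
Proof.
by move=> /flat_algebra_diff[df _] x; exact: differentiable_continuous.
Qed.

End FlatAlgebra.

(** * Integration by parts *)

Section IntegrationByParts.
Context {R : realType}.
Implicit Types (f g : plane R -> R) (x : plane R).
Local Notation mu := (mu2 R).
Local Notation leb := (@lebesgue_measure R).

(** The fundamental theorem of calculus on [[a, b]], outside of which the integrand is zero. *)
Lemma integral_derivative_eq0 (g g' : R -> R) (a b : R) : a < b ->
  (forall s : R, is_derive s (1 : R) g (g' s)) -> continuous g' ->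
  g a = 0 -> g b = 0 -> (forall s, s \notin `[a, b] -> g' s = 0) ->
  (\int[leb]_s (g' s)%:E = 0)%E.
Proof.
move=> ab gg' cg' ga gb g'0.
have cg : continuous g.
  by move=> s; apply/differentiable_continuous/derivable1_diffP; have [] := gg' s.
rewrite (_ : (\int[leb]_s (g' s)%:E = \int[leb]_(s in `[a, b]) (g' s)%:E)%E).
  rewrite (@continuous_FTC2 _ g' g)//; first by rewrite ga gb subee.
  - exact: continuous_subspaceT.
  - split; first by move=> s _; have [] := gg' s.
    + exact/cvg_at_right_filter/cg.
    + exact/cvg_at_left_filter/cg.
  - by move=> s _; rewrite derive1E; have [_ ->] := gg' s.
rewrite [RHS]integral_mkcond; apply: eq_integral => s _.
by rewrite patchE; case: ifPn => // /negP sab; rewrite g'0//; apply/negP => h;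
  apply: sab; rewrite inE.
Qed.

Definition crect (a b c d : R) : set (plane R) := `[a, b] `*` `[c, d].

Lemma crect_compact a b c d : compact (crect a b c d).
Proof. by apply: compact_setX; exact: segment_compact. Qed.

Lemma crect_measurable a b c d : measurable (crect a b c d).
Proof. by apply: measurableX; exact: measurable_itv. Qed.

Lemma crect_fin a b c d : (mu (crect a b c d) < +oo)%E.
Proof.
rewrite /crect product_measure1E//; try exact: measurable_itv.
have fin (u v : R) : (leb `[u, v] < +oo)%E.
  by rewrite lebesgue_measure_itv/=; case: ifP => _; rewrite ?ltry.
apply: lte_mul_pinfty; [by []| |exact: fin].
by rewrite ge0_fin_numE//; exact: fin.
Qed.

Lemma flat_algebra_integrable_crect f a b c d : flat_algebra f ->
  mu.-integrable (crect a b c d) (EFin \o f).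
Proof.
move=> Ff; have mR := crect_measurable a b c d.
have /compact_bounded[M [_ MP]] : compact (f @` crect a b c d).
  apply: continuous_compact; last exact: crect_compact.
  exact/continuous_subspaceT/flat_algebra_continuous.
apply: (@le_integrable _ _ _ mu _ mR _ (EFin \o cst (M + 1))).
- apply/measurable_EFinP; apply: measurable_funTS.
  exact: flat_algebra_measurable.
- move=> x rx; rewrite lee_fin (le_trans _ (ler_norm _))//.
  by apply: MP; [rewrite ltrDl|exists x].
apply/integrableP; split.
  by apply/measurable_EFinP; exact: measurable_cst.
under eq_integral do rewrite /=.
by rewrite integral_cst// lte_mul_pinfty ?lee_fin//; exact: crect_fin.
Qed.

Lemma flat_algebra_integrable f a b c d : flat_algebra f ->
  (forall x, ~ crect a b c d x -> f x = 0) ->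
  mu.-integrable setT (EFin \o f).
Proof.
move=> Ff f0; have -> : EFin \o f = (EFin \o f) \_ (crect a b c d).
  by apply/funext => x /=; rewrite patchE; case: ifPn => // /negP rx;
    rewrite f0// => /mem_set.
apply/(integrable_mkcond _ (crect_measurable a b c d)).
exact: flat_algebra_integrable_crect.
Qed.

Lemma is_derive_slice1 f (s t d : R) : is_derive ((s, t) : plane R) (1, 0) f d ->
  is_derive s (1 : R) (fun s => f (s, t)) d.
Proof.
have E : (fun h : R => h^-1 *: ((f \o shift ((s, t) : plane R)) (h *: (1, 0)) - f (s, t)))
   = (fun h : R => h^-1 *: (((fun s => f (s, t)) \o shift s) (h *: 1) - f (s, t))).
  apply/funext => h /=; congr (_ *: (f _ - _)).
  by rewrite [LHS]/GRing.add/= /add_pair/= [X in (_, X + _)]mulr0 add0r.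
move=> [df <-]; split; first by rewrite /derivable -E.
by rewrite /derive -E.
Qed.

Lemma is_derive_slice2 f (s t d : R) : is_derive ((s, t) : plane R) (0, 1) f d ->
  is_derive t (1 : R) (fun t => f (s, t)) d.
Proof.
have E : (fun h : R => h^-1 *: ((f \o shift ((s, t) : plane R)) (h *: (0, 1)) - f (s, t)))
   = (fun h : R => h^-1 *: (((fun t => f (s, t)) \o shift t) (h *: 1) - f (s, t))).
  apply/funext => h /=; congr (_ *: (f _ - _)).
  by rewrite [LHS]/GRing.add/= /add_pair/= [X in (X + _, _)]mulr0 add0r.
move=> [df <-]; split; first by rewrite /derivable -E.
by rewrite /derive -E.
Qed.

(** The complement of the compact rectangle is open, so [f] is zero near each of its points. *)
Lemma pderiv_crect0 i f a b c d : 
  (forall x, ~ crect a b c d x -> f x = 0) ->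
  forall x, ~ crect a b c d x -> pderiv i f x = 0.
Proof.
move=> f0 x rx; have : open (~` crect a b c d).
  apply: closed_openC; apply: compact_closed (@crect_compact a b c d).
  exact: norm_hausdorff.
rewrite openE => /(_ x rx) nx; rewrite /pderiv.
rewrite (near_eq_derive (f := f) (g := cst 0)) ?derive_cst//.
by apply: filterS nx => y; exact: f0.
Qed.

(** Fubini, with the variable of differentiation integrated first. As [f] vanishes off the open
    rectangle, each slice is zero at both end points. *)
Lemma integral_pderiv_eq0 i f a b c d : flat_algebra f -> a < b -> c < d ->
  (forall x, ~ (`]a, b[ `*` `]c, d[) x -> f x = 0) ->
  (\int[mu]_x (pderiv i f x)%:E = 0)%E.
Proof.
move=> Ff ab cd f0.
have f0' x : ~ crect a b c d x -> f x = 0.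
  move=> rx; apply: f0 => -[x1 x2]; apply: rx; split.
    exact: subset_itv_oo_cc x1.
  exact: subset_itv_oo_cc x2.
have F'f := flat_algebra_pderiv i Ff.
have if' := flat_algebra_integrable F'f (pderiv_crect0 i f0').
have [df _] := flat_algebra_diff Ff.
have dfi x : is_derive x (basis_vec i) f (pderiv i f x).
  by apply: DeriveDef => //; exact: diff_derivable.
have cF' := flat_algebra_continuous F'f.
have : i = ord0 \/ i = ord_max.
  by case: i {F'f if' dfi cF'} => -[|[|//]] ?; [left|right]; exact: val_inj.
move=> [i0|i1].
- rewrite -(integral21_prod_meas1 if') /fubini_G integral0_eq// => t _.
  apply: (@integral_derivative_eq0 (fun s => f (s, t)) _ a b) => //.
  + by move=> s; apply: is_derive_slice1; have := dfi (s, t); rewrite i0.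
  + move=> s; apply: (@continuous_comp _ _ _ (fun s : R => (s, t) : plane R)).
      by apply: (@cvg_pair _ _ _ _ (nbhs s) (nbhs t)); [exact: cvg_id|exact: cvg_cst].
    exact: cF'.
  + by apply: f0 => -[/=]; rewrite in_itv/= ltxx.
  + by apply: f0 => -[/=]; rewrite in_itv/= ltxx andbF.
  + by move=> s sab; apply: (pderiv_crect0 i f0') => -[/= h]; move: sab; rewrite h.
rewrite -(integral12_prod_meas1 if') /fubini_F integral0_eq// => s _.
apply: (@integral_derivative_eq0 (fun t => f (s, t)) _ c d) => //.
- by move=> t; apply: is_derive_slice2; have := dfi (s, t); rewrite i1.
- move=> t; apply: (@continuous_comp _ _ _ (fun t : R => (s, t) : plane R)).
    by apply: (@cvg_pair _ _ _ _ (nbhs s) (nbhs t)); [exact: cvg_cst|exact: cvg_id].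
  exact: cF'.
- by apply: f0 => -[/= _]; rewrite in_itv/= ltxx.
- by apply: f0 => -[/= _]; rewrite in_itv/= ltxx andbF.
- by move=> t sab; apply: (pderiv_crect0 i f0') => -[/= _ h]; move: sab; rewrite h.
Qed.

End IntegrationByParts.

(** * Functions with vanishing integral over rectangles *)

Section Rectangles.
Context {R : realType}.
Implicit Types (f g : plane R -> R) (x : plane R).
Local Notation mu := (mu2 R).

Definition orect (a b c d : R) : set (plane R) := `]a, b[ `*` `]c, d[.

Definition orects : set (set (plane R)) :=
  [set A | exists a b c d, A = orect a b c d].

Lemma orectI a b c d a' b' c' d' : orect a b c d `&` orect a' b' c' d' =
  orect (Num.max a a') (Num.min b b') (Num.max c c') (Num.min d d').
Proof.
apply/seteqP; split => -[x y]; rewrite /orect /= !in_itv/= !gt_max !lt_min.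
  by move=> [[/andP[-> ->]/andP[-> ->]] [/andP[-> ->]/andP[-> ->]]].
move=> [/andP[/andP[-> ->]/andP[-> ->]] /andP[/andP[-> ->]/andP[-> ->]]].
by [].
Qed.

Lemma orect_measurable a b c d : measurable (orect a b c d).
Proof. by apply: measurableX; exact: measurable_itv. Qed.

Let G := g_sigma_algebraType orects.

Let bigcup_orect a b c d :
  (forall n : nat, measurable (orect (a n) (b n) (c n) (d n) : set G)) ->
  measurable (\bigcup_n orect (a n) (b n) (c n) (d n) : set G).
Proof. by move=> h; exact: bigcupT_measurable. Qed.

Let ltn_truncn (y : R) : y < (Num.truncn `|y|).+1%:R.
Proof.
by rewrite (le_lt_trans (ler_norm y))// truncnS_gt.
Qed.

(** The product sigma-algebra is generated by the two coordinates, and the preimage of a half-line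
    under a coordinate is a countable union of bounded open rectangles. So the identity is
    measurable from [G] to the plane. *)
Lemma measurable_orects : @measurable _ (plane R) `<=` <<s orects >>.
Proof.
have bnd (n : nat) (y : R) : (Num.truncn `|y| <= n)%N -> y < n.+1%:R /\ - n.+1%:R < y.
  move=> yn; have y1 := ltn_truncn y; have y2 := ltn_truncn (- y).
  have : (Num.truncn `|y|).+1%:R <= n.+1%:R :> R by rewrite ler_nat ltnS.
  move: y1 y2; rewrite normrN => *; split; lra.
have m1 : measurable_fun [set: G] (fst : G -> measurableTypeR R).
  apply: measurability; first exact: RGenOInfty.measurableE.
  move=> _ [_ [x ->] <-]; rewrite setTI.
  have -> : fst @^-1` `]x, +oo[%classic =
      \bigcup_n orect x n.+1%:R (- n.+1%:R) n.+1%:R.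
    apply/seteqP; split => [[u v]/=|[u v] [n _ []]/=].
      rewrite in_itv/= andbT => xu.
      pose n := maxn (Num.truncn `|u|) (Num.truncn `|v|).
      have [u1 u2] := bnd n u (leq_maxl _ _); have [v1 v2] := bnd n v (leq_maxr _ _).
      by exists n => //; split; rewrite /= in_itv/= ?xu ?u1 ?v1 ?v2.
    by rewrite !in_itv/= => /andP[->].
  by apply: bigcup_orect => n; apply: sub_sigma_algebra; do 4 eexists.
have m2 : measurable_fun [set: G] (snd : G -> measurableTypeR R).
  apply: measurability; first exact: RGenOInfty.measurableE.
  move=> _ [_ [x ->] <-]; rewrite setTI.
  have -> : snd @^-1` `]x, +oo[%classic =
      \bigcup_n orect (- n.+1%:R) n.+1%:R x n.+1%:R.
    apply/seteqP; split => [[u v]/=|[u v] [n _ []]/=].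
      rewrite in_itv/= andbT => xv.
      pose n := maxn (Num.truncn `|u|) (Num.truncn `|v|).
      have [u1 u2] := bnd n u (leq_maxl _ _); have [v1 v2] := bnd n v (leq_maxr _ _).
      by exists n => //; split; rewrite /= in_itv/= ?xv ?u1 ?u2 ?v1.
    by rewrite !in_itv/= => _ /andP[->].
  by apply: bigcup_orect => n; apply: sub_sigma_algebra; do 4 eexists.
have mid : measurable_fun [set: G] (id : G -> plane R).
  by apply/measurable_fun_pairP.
by move=> A mA; have := mid measurableT A mA; rewrite setTI.
Qed.

(** Dynkin's pi-lambda theorem: open rectangles are stable under intersection and generate, while
    the sets over which [h] integrates to zero form a lambda-system. The vanishing total integral
    handles complements. *)
Lemma orects_ae_eq0 (h : plane R -> R) : mu.-integrable setT (EFin \o h) ->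
  (\int[mu]_x (h x)%:E = 0)%E ->
  (forall a b c d, \int[mu]_(x in orect a b c d) (h x)%:E = 0)%E ->
  {ae mu, forall x, h x = 0}.
Proof.
move=> ih hT hrect.
suff hA A : measurable A -> (\int[mu]_(x in A) (h x)%:E = 0)%E.
  have := @integral_ae_eq _ _ _ mu setT measurableT (cst 0%E) (EFin \o h) ih _ _.
  case=> //.
  - by move=> A _ /hA ->; rewrite integral0.
  - move=> N [mN N0 hN]; exists N; split => // x hx; apply: hN => /= /(_ I) [] h0.
    by apply: hx; rewrite -h0.
pose P (A : set (plane R)) := (\int[mu]_(x in A) (h x)%:E = 0)%E.
have mrect : @measurable _ (plane R) = <<s orects >>.
  apply/seteqP; split; first exact: measurable_orects.
  apply: smallest_sub; first exact: sigma_algebra_measurable.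
  by move=> _ [a [b [c [d ->]]]]; exact: orect_measurable.
rewrite {1}mrect; move: A; apply: (@dynkin_induction _ _ orects P mrect) => //.
- move=> _ _ [a [b [c [d ->]]]] [a' [b' [c' [d' ->]]]].
  by rewrite orectI; do 4 eexists.
- by move=> _ [a [b [c [d ->]]]]; exact: hrect.
- move=> S mS PS; have := hT; rewrite -(setvU S).
  rewrite integral_setU//; first 1 last.
  + exact: measurableC.
  + by rewrite setvU; exact: measurable_int ih.
  + by rewrite disj_set2E setICl.
  by rewrite [X in (_ + X)%E]PS adde0.
- move=> F mF tF PF; rewrite /P integral_bigcup//.
    by rewrite eseries0// => i _ _; exact: PF.
  apply: integrableS ih => //; exact: bigcupT_measurable.
Qed.

End Rectangles.

(** * Test functions approximating indicators of rectangles *)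

Section Bumps.
Context {R : realType}.
Implicit Types (f g : plane R -> R) (x : plane R).
Local Notation mu := (mu2 R).
Local Notation e := (flat_exp (1 : {poly R})).

Lemma flat_exp1_ge0 t : 0 <= e t.
Proof. by rewrite /flat_exp; case: ifP => // _; rewrite hornerC mul1r expR_ge0. Qed.

Lemma flat_exp1_le1 t : e t <= 1.
Proof.
rewrite /flat_exp; case: ifPn => // t0.
by rewrite hornerC mul1r -expR0 ler_expR oppr_le0 invr_ge0 ltW.
Qed.

Lemma flat_exp1_le0 t : t <= 0 -> e t = 0.
Proof. by move=> t0; rewrite /flat_exp ltNge t0. Qed.

Lemma flat_exp1_cvg1 t : 0 < t -> e (n.+1%:R * t) @[n --> \oo] --> (1 : R).
Proof.
move=> t0.
have -> : (fun n => e (n.+1%:R * t)) =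
    (fun n => expR (- (n.+1%:R^-1 * t^-1))).
  apply/funext => n; rewrite /flat_exp pmulr_lgt0// ltr0n/= hornerC mul1r.
  by rewrite invfM.
have g0 : - (n.+1%:R^-1 * t^-1) @[n --> \oo] --> (0 : R).
  rewrite -oppr0 -(mul0r t^-1); apply: cvgN.
  by apply: cvgM; [exact: cvg_harmonic|exact: cvg_cst].
by have := cvg_comp _ _ g0 (@continuous_expR R 0); rewrite expR0; exact.
Qed.

(* Increases to the indicator of the open rectangle as [n] goes to infinity. *)
Definition flat_bump (a b c d : R) (n : nat) : plane R -> R := fun x =>
  (e \o affine n.+1%:R 0 (- (n.+1%:R * a))) x *
  (e \o affine (- n.+1%:R) 0 (n.+1%:R * b)) x *
  ((e \o affine 0 n.+1%:R (- (n.+1%:R * c))) x *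
   (e \o affine 0 (- n.+1%:R) (n.+1%:R * d)) x).

Lemma flat_bumpE a b c d n x : flat_bump a b c d n x =
  e (n.+1%:R * (x.1 - a)) * e (n.+1%:R * (b - x.1)) *
  (e (n.+1%:R * (x.2 - c)) * e (n.+1%:R * (d - x.2))).
Proof. by rewrite /flat_bump/=; congr (e _ * e _ * (e _ * e _)); rewrite /affine; ring. Qed.

Lemma flat_algebra_bump a b c d n : flat_algebra (flat_bump a b c d n).
Proof. by apply: flat_mul; apply: flat_mul; exact: flat_flat_exp. Qed.

Lemma flat_bump_ge0 a b c d n x : 0 <= flat_bump a b c d n x.
Proof. by rewrite !mulr_ge0 ?flat_exp1_ge0. Qed.

Lemma flat_bump_le1 a b c d n x : flat_bump a b c d n x <= 1.
Proof.
by rewrite !mulr_ile1 ?mulr_ge0 ?flat_exp1_ge0 ?flat_exp1_le1.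
Qed.

Lemma flat_bump_out a b c d n x : ~ orect a b c d x -> flat_bump a b c d n x = 0.
Proof.
move=> rx; apply/eqP; apply: contra_notT rx; rewrite flat_bumpE !mulf_eq0 !negb_or.
have pos t : e (n.+1%:R * t) != 0 -> 0 < t.
  by apply: contraNT; rewrite -leNgt => t0; rewrite flat_exp1_le0// mulr_ge0_le0.
move=> /andP[/andP[/pos h1 /pos h2] /andP[/pos h3 /pos h4]].
move: h1 h2 h3 h4; rewrite !subr_gt0 => h1 h2 h3 h4.
by split; rewrite /= in_itv/= ?h1 ?h2 ?h3 ?h4.
Qed.

Lemma flat_bump_cvg1 a b c d x : orect a b c d x -> flat_bump a b c d n x @[n --> \oo] --> (1 : R).
Proof.
move=> [/=]; rewrite !in_itv/= => /andP[h1 h2] /andP[h3 h4].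
under eq_fun do rewrite flat_bumpE.
have cvg1 u v : u < v -> e (n.+1%:R * (v - u)) @[n --> \oo] --> (1 : R).
  by move=> uv; apply: flat_exp1_cvg1; rewrite subr_gt0.
have cvgM1 (u v : R^nat) : u n @[n --> \oo] --> (1 : R) ->
    v n @[n --> \oo] --> (1 : R) -> u n * v n @[n --> \oo] --> (1 : R).
  move=> cu cv; have := cvgM cu cv. rewrite mulr1; exact.
exact: cvgM1 (cvgM1 _ _ (cvg1 _ _ h1) (cvg1 _ _ h2))
  (cvgM1 _ _ (cvg1 _ _ h3) (cvg1 _ _ h4)).
Qed.

(** Dominated convergence with bound [|h|], the bumps lying between [0] and [1]. *)
Lemma integral_orect_eq0 (h : plane R -> R) a b c d :
  mu.-integrable setT (EFin \o h) ->
  (forall n, \int[mu]_x (h x * flat_bump a b c d n x)%:E = 0)%E ->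
  (\int[mu]_(x in orect a b c d) (h x)%:E = 0)%E.
Proof.
move=> ih hb; rewrite integral_mkcond.
have mh : measurable_fun setT h by apply/measurable_EFinP; exact: measurable_int ih.
have [] := @dominated_convergence _ _ _ mu setT measurableT
  (fun n x => (h x * flat_bump a b c d n x)%:E)
  ((EFin \o h) \_ (orect a b c d)) (abse \o (EFin \o h)).
- move=> n; apply/measurable_EFinP; apply: measurable_funM => //.
  by apply: flat_algebra_measurable; exact: flat_algebra_bump.
- apply/measurable_restrict => //; first exact: orect_measurable.
  apply: measurable_funS (measurable_int _ ih) => //.
- apply: aeW => x _; rewrite patchE; case: ifPn => [/set_mem rx|/negP rx].
    apply/cvg_EFin; first by exact: nearW.
    rewrite -[X in _ --> X]mulr1; apply: cvgM; first exact: cvg_cst.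
    exact: flat_bump_cvg1.
  suff -> : (fun n => (h x * flat_bump a b c d n x)%:E) = (fun=> 0%E) by exact: cvg_cst.
  by apply/funext => n; rewrite flat_bump_out ?mulr0// => /mem_set.
- exact: integrable_abse.
- apply: aeW => x n _ /=; rewrite lee_fin normrM.
  by rewrite ler_piMr// ger0_norm ?flat_bump_ge0 ?flat_bump_le1.
move=> _ _; set s := (X in X @ _ --> _ -> _).
have -> : s = cst 0%E by apply/funext => n; exact: hb.
by move=> /cvg_lim <- //; rewrite lim_cst.
Qed.

End Bumps.

(** * Weak derivatives of piecewise polynomials *)

Section WeakDerivative.
Context {R : realType}.
Implicit Types (f g p : plane R -> R) (x : plane R).
Local Notation mu := (mu2 R).

Lemma orect_sub_crect a b c d : orect a b c d `<=` @crect R a b c d.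
Proof. by move=> x [x1 x2]; split; exact: subset_itv_oo_cc. Qed.

Lemma orect_empty (a b c d : R) : b <= a \/ d <= c -> orect a b c d = set0.
Proof.
move=> h; apply/seteqP; split => // -[x y] [/=]; rewrite !in_itv/=.
move=> /andP[h1 h2] /andP[h3 h4].
by case: h => [/(lt_le_trans (lt_trans h1 h2))|/(lt_le_trans (lt_trans h3 h4))];
  rewrite ltxx.
Qed.

Lemma flat_algebra_integrable_orect f a b c d : flat_algebra f ->
  mu.-integrable setT (EFin \o (f \_ (orect a b c d))).
Proof.
move=> Ff; have mr := orect_measurable a b c d.
rewrite -restrict_EFin; apply/(integrable_mkcond _ mr).
apply: integrableS (flat_algebra_integrable_crect a b c d Ff) => //.
  exact: crect_measurable.
exact: orect_sub_crect.
Qed.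

(** On a bounded rectangle the square-integrable [f] is dominated by the integrable [f^2 + 1]. *)
Lemma L2_integrable_orect Omega f a b c d : L2 Omega f ->
  orect a b c d `<=` Omega ->
  mu.-integrable setT (EFin \o (f \_ (orect a b c d))).
Proof.
move=> Lf rO; have mr := orect_measurable a b c d.
have fE : f \_ (orect a b c d) = (f \_ Omega) \_ (orect a b c d).
  apply/funext => x; rewrite !patchE; case: ifPn => // /set_mem/rO Ox.
  by rewrite mem_set.
have mf : measurable_fun setT (f \_ (orect a b c d)).
  rewrite fE; apply/(measurable_restrictT _ mr)/measurable_funTS.
  exact: L2_measurable.
have i1 := flat_algebra_integrable_orect a b c d (flat_cst 1).
have := integrableD measurableT (Lfun2_integrable_sqr Lf) i1.
apply: le_integrable => //; first exact/measurable_EFinP.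
move=> x _; rewrite lee_fin/= fE !(patchE _ (orect _ _ _ _)).
case: ifPn => _; last by rewrite normr0.
apply: le_trans (ler_norm _).
set y := (f \_ Omega) x; rewrite -[y ^+ 2]real_normK ?num_real//.
have := normr_ge0 y; set z := `|y|; have := sqr_ge0 (z - 1); nra.
Qed.

(** For a bump [phi], the integral of [(g - pderiv i p) * phi] is minus that of
    [pderiv i (p * phi)], which is zero by compact support. Bumps on all subrectangles then
    determine [g - pderiv i p] almost everywhere. *)
Lemma weak_pderiv_ae_orect Omega i f g p a b c d :
  L2 Omega f -> L2 Omega g -> weak_pderiv Omega i f g -> flat_algebra p ->
  crect a b c d `<=` Omega ->
  {ae mu, forall x, crect a b c d x -> f x = p x} ->
  {ae mu, forall x, orect a b c d x -> g x = pderiv i p x}.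
Proof.
move=> Lf Lg wfg Fp rO fp.
set r := orect a b c d.
have mr : measurable r by exact: orect_measurable.
have orO : r `<=` Omega := subset_trans (@orect_sub_crect _ _ _ _) rO.
have FDp := flat_algebra_pderiv i Fp.
have ig : mu.-integrable setT (EFin \o (g \_ r)) := L2_integrable_orect Lg orO.
have ip : mu.-integrable setT (EFin \o (pderiv i p \_ r)).
  exact: flat_algebra_integrable_orect.
pose h x := (g \_ r) x - (pderiv i p \_ r) x.
have ih : mu.-integrable setT (EFin \o h) by exact: (integrableB measurableT ig ip).
(* [h] vanishes off [r], so any rectangle may be replaced by its intersection with [r], which is
   again a rectangle. *)
suff sub a' b' c' d' : a <= a' -> b' <= b -> c <= c' -> d' <= d ->
    (\int[mu]_(x in orect a' b' c' d') (h x)%:E = 0)%E.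
  have inter (A : set (plane R)) : (\int[mu]_(x in A) (h x)%:E =
      \int[mu]_(x in A `&` r) (h x)%:E)%E.
    rewrite [RHS]integral_mkcondr; apply: eq_integral => x _.
    by rewrite patchE; case: ifPn => // xr; rewrite /h !patchE (negbTE xr) subrr.
  suff : {ae mu, forall x, h x = 0}.
    apply: filterS => x hx rx; apply/eqP; rewrite -subr_eq0 -[X in _ == X]hx.
    by rewrite /h !patchE mem_set.
  apply: orects_ae_eq0 => // [|a' b' c' d'].
    by rewrite inter setTI sub.
  by rewrite inter orectI; apply: sub; rewrite ?ge_min ?le_max lexx ?orbT.
move=> aa' b'b cc' d'd; have [b'a'|a'b'] := leP b' a'.
  by rewrite orect_empty ?integral_set0//; left.
have [d'c'|c'd'] := leP d' c'.
  by rewrite orect_empty ?integral_set0//; right.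
apply: integral_orect_eq0 => // n.
have kk : crect a' b' c' d' `<=` crect a b c d.
  move=> x [/=]; rewrite !in_itv/= => /andP[h1 h2] /andP[h3 h4].
  split; rewrite /= in_itv/=; apply/andP; split.
  - exact: le_trans h1.
  - exact: le_trans h2 _.
  - exact: le_trans h3.
  - exact: le_trans h4 _.
have oo x : orect a' b' c' d' x -> r x.
  move=> [/=]; rewrite !in_itv/= => /andP[h1 h2] /andP[h3 h4].
  split; rewrite /= in_itv/=; apply/andP; split.
  - exact: le_lt_trans h1.
  - exact: lt_le_trans h2 _.
  - exact: le_lt_trans h3.
  - exact: lt_le_trans h4 _.
set phi := flat_bump a' b' c' d' n.
have Fphi : flat_algebra phi by exact: flat_algebra_bump.
have phi0 x : ~ crect a' b' c' d' x -> phi x = 0.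
  by move=> kx; apply: flat_bump_out => /orect_sub_crect.
have Dphi0 := pderiv_crect0 i phi0.
have phir0 x : ~ r x -> phi x = 0 by move=> rx; apply: flat_bump_out => /oo.
have tphi : test_function Omega phi.
  split; first exact: flat_algebra_smooth.
  exists (crect a' b' c' d'); split => //; first exact: crect_compact.
  exact: subset_trans kk rO.
have FDphi := flat_algebra_pderiv i Fphi.
have ipD : mu.-integrable setT (EFin \o (fun x => p x * pderiv i phi x)).
  apply: (flat_algebra_integrable (flat_mul Fp FDphi)) => x /Dphi0 Dx.
  by rewrite Dx mulr0.
have iDp : mu.-integrable setT (EFin \o (fun x => phi x * pderiv i p x)).
  apply: (flat_algebra_integrable (flat_mul Fphi FDp)) => x /phi0 px.
  by rewrite px mul0r.
have mphi := flat_algebra_measurable Fphi.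
have iphi (u : plane R -> R) : mu.-integrable setT (EFin \o u) ->
    mu.-integrable setT (EFin \o (fun x => u x * phi x)).
  move=> iu; apply: le_integrable (iu) => //.
    apply/measurable_EFinP/measurable_funM => //.
    by apply/measurable_EFinP; exact: measurable_int iu.
  move=> x _; rewrite lee_fin/= normrM ler_piMr//.
  by rewrite ger0_norm ?flat_bump_ge0 ?flat_bump_le1.
have ihphi := iphi _ ih.
suff R0 : \int[mu]_x (h x * phi x) = 0.
  by rewrite -[LHS]fineK ?integrable_fin_num//; congr EFin.
have -> : \int[mu]_x (h x * phi x) =
    \int[mu]_x ((g \_ r) x * phi x) - \int[mu]_x (phi x * pderiv i p x).
  rewrite -RintegralB//; last exact: iphi.
  apply: eq_Rintegral => x _; rewrite /h mulrBl; congr (_ - _).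
  rewrite patchE mulrC; case: ifPn => // /negP rx.
  by rewrite phir0 ?mul0r// => /mem_set.
have -> : \int[mu]_x ((g \_ r) x * phi x) = \int[mu]_(x in Omega) (g x * phi x).
  rewrite [RHS]Rintegral_mkcond; apply: eq_Rintegral => x _.
  rewrite !patchE; case: ifPn => [/set_mem/orO Ox|/negP rx].
    by rewrite mem_set.
  rewrite phir0 ?mulr0; last by move=> /mem_set.
  by case: ifPn; rewrite ?mul0r ?mulr0.
(* The weak derivative is tested with [phi]; then [f] is replaced by [p], with which it agrees
   almost everywhere on the rectangle, off which the derivative of [phi] is zero. *)
have -> : \int[mu]_(x in Omega) (g x * phi x) = - \int[mu]_x (p x * pderiv i phi x).
  rewrite -[LHS]opprK -wfg//; congr (- _).
  rewrite Rintegral_mkcond /Rintegral; congr fine.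
  have fE : (fun x => f x * pderiv i phi x) \_ Omega =
      (fun x => (f \_ Omega) x * pderiv i phi x).
    by apply/funext => x; rewrite !patchE; case: ifPn => // _; rewrite mul0r.
  apply: ae_eq_integral => //.
  - rewrite fE; apply/measurable_EFinP/measurable_funM; first exact: L2_measurable.
    exact: flat_algebra_measurable.
  - exact: measurable_int ipD.
  - apply: filterS fp => x fx _; rewrite fE; congr EFin.
    have [kx|kx] := pselect (crect a' b' c' d' x); last by rewrite Dphi0// !mulr0.
    by rewrite patchE mem_set ?fx//; [exact: kk|exact/rO/kk].
(* The product rule assembles the two integrands into the derivative of [p * phi]. *)
rewrite -opprD -RintegralD// -[RHS]oppr0; congr (- _).
under eq_Rintegral do rewrite -flat_algebra_pderivM//.
rewrite /Rintegral (integral_pderiv_eq0 i (flat_mul Fp Fphi) a'b' c'd')// => x ox.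
by rewrite /phi flat_bump_out ?mulr0.
Qed.

End WeakDerivative.

(** * Passage from rectangles to open sets, and null lines *)

Section Open.
Context {R : realType}.
Implicit Types (f g p : plane R -> R) (x : plane R).
Local Notation mu := (mu2 R).

Lemma ae_countable (K : countType) (P : K -> plane R -> Prop) :
  (forall k, {ae mu, forall x, P k x}) -> {ae mu, forall x, forall k, P k x}.
Proof.
move=> aeP.
have : {ae mu, forall x, forall n, if unpickle n is Some k then P k x else True}.
  by apply/ae_foralln => n; case: unpickle => [k|]; [exact: aeP|exact: aeW].
by apply: filterS => x Px k; have := Px (pickle k); rewrite pickleK.
Qed.

(** Rational end points make the family of rectangles countable, so that the exceptional null sets
    of all of them together remain null. *)
Lemma open_crect (U : set (plane R)) x : open U -> U x ->
  exists q : (rat * rat) * (rat * rat),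
    orect (ratr q.1.1) (ratr q.1.2) (ratr q.2.1) (ratr q.2.2) x /\
    crect (ratr q.1.1) (ratr q.1.2) (ratr q.2.1) (ratr q.2.2) `<=` U.
Proof.
rewrite openE => /[apply] /nbhs_ballP[e /= e0 eU].
have itv (y : R) : exists q : rat * rat,
    (ratr q.1 : R) < y < ratr q.2 /\ y - e < ratr q.1 /\ ratr q.2 < y + e.
  have [|q1 +] := @rat_in_itvoo R (y - e) y; first by rewrite ltrBlDr ltrDl.
  have [|q2 +] := @rat_in_itvoo R y (y + e); first by rewrite ltrDl.
  rewrite !in_itv/= => /andP[h3 h4] /andP[h1 h2].
  by exists (q1, q2) => /=; rewrite h4 h1 h2 h3.
have [q1 [h1 [l1 r1]]] := itv x.1; have [q2 [h2 [l2 r2]]] := itv x.2.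
exists (q1, q2); split; first by split; rewrite /= in_itv/=.
move=> y [/=]; rewrite !in_itv/= => /andP[a1 b1] /andP[a2 b2].
apply: eU; split; rewrite /ball/= ltr_distlC; apply/andP; split; lra.
Qed.

Lemma weak_pderiv_ae_open Omega (U : set (plane R)) i f g p :
  L2 Omega f -> L2 Omega g -> weak_pderiv Omega i f g -> flat_algebra p ->
  open U -> U `<=` Omega ->
  {ae mu, forall x, U x -> f x = p x} ->
  {ae mu, forall x, U x -> g x = pderiv i p x}.
Proof.
move=> Lf Lg wfg Fp oU UO fp.
have : {ae mu, forall x, forall q : (rat * rat) * (rat * rat),
    crect (ratr q.1.1) (ratr q.1.2) (ratr q.2.1) (ratr q.2.2) `<=` U ->
    orect (ratr q.1.1) (ratr q.1.2) (ratr q.2.1) (ratr q.2.2) x ->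
    g x = pderiv i p x}.
  apply: ae_countable => q.
  have [qU|qU] := pselect (crect (ratr q.1.1) (ratr q.1.2) (ratr q.2.1) (ratr q.2.2)
    `<=` U); last by apply: aeW => x /qU.
  suff : {ae mu, forall x, orect (ratr q.1.1) (ratr q.1.2) (ratr q.2.1) (ratr q.2.2)
      x -> g x = pderiv i p x} by apply: filterS => x hx _.
  apply: weak_pderiv_ae_orect wfg Fp _ _ => //; first exact: subset_trans qU UO.
  by apply: filterS fp => x fx /qU.
by apply: filterS => x hx Ux; have [q [xq qU]] := open_crect oU Ux; exact: hx xq.
Qed.

(** The zero set is a line. A vertical line is a point times [R]; any other line meets each vertical
    section in one point, and Fubini applies. *)
Lemma affine_ae_neq0 (a b c : R) : (a != 0) || (b != 0) ->
  {ae mu, forall x, affine a b c x != 0}.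
Proof.
move=> ab; pose N : set (plane R) := [set x | affine a b c x = 0].
have mN : measurable N.
  have -> : N = affine a b c @^-1` [set 0] by [].
  by rewrite -[X in measurable X]setTI; exact: measurable_affine.
exists N; split => //; last by move=> x /negP; rewrite negbK => /eqP.
have [b0|b0] := eqVneq b 0.
  rewrite b0 eqxx orbF in ab.
  have -> : N = [set - c / a] `*` setT.
    apply/seteqP; split => -[u v]; rewrite /N/= /affine b0/= mul0r addr0.
      by move=> h; split => //; apply: (mulfI ab); rewrite mulrCA divff// mulr1; lra.
    by move=> [-> _]; field.
  have m1 : measurable ([set - c / a] : set (measurableTypeR R)).
    exact: measurable_set1.
  rewrite product_measure1E//.
  by rewrite [X in (X * _)%E]lebesgue_measure_set1 mul0e.
rewrite /product_measure1 /=; apply: integral0_eq => u _ /=.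
have -> : xsection N u = [set - (a * u + c) / b].
  apply/seteqP; split => v; rewrite /xsection/= inE /N/= /affine/=.
    by move=> h; apply: (mulfI b0); rewrite mulrCA divff// mulr1; lra.
  by move=> ->; field.
exact: lebesgue_measure_set1.
Qed.

End Open.

(** * Triangles *)

Section Hulls.
Context {R : realType}.
Implicit Types (t : triangle R) (x u v : plane R).
Local Notation mu := (mu2 R).

(* [D] times the determinant of [u - x] and [v - x]. *)
Definition edge_coord (D : R) u v : plane R -> R :=
  affine (D * (u.2 - v.2)) (D * (v.1 - u.1)) (D * (u.1 * v.2 - u.2 * v.1)).

Lemma edge_coord_open D u v : open [set x | 0 < edge_coord D u v x].
Proof.
apply: (@open_comp _ _ (edge_coord D u v) [set y | 0 < y]); last exact: open_gt.
by move=> x _; exact/flat_algebra_continuous/flat_affine.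
Qed.

Lemma edge_coord_ae_neq0 D u v : D != 0 -> u <> v ->
  {ae mu, forall x, edge_coord D u v x != 0}.
Proof.
move=> D0 uv; apply: affine_ae_neq0; rewrite !mulf_eq0 !(negbTE D0)/= !subr_eq0.
apply: contra_notT uv; rewrite negb_or !negbK => /andP[/eqP h2 /eqP h1].
by apply/eqP; rewrite -pair_eqE /pair_eq /= h1 h2 !eqxx.
Qed.

(** [U] is the part of [Omega] where the three barycentric coordinates are positive. The rest of the
    triangle lies on the lines through its edges, which are null. *)
Lemma hull_ae_interior (Omega : set (plane R)) t : open Omega -> Defs.nondegenerate t ->
  exists U : set (plane R), [/\ open U, U `<=` Omega `&` hull t &
    {ae mu, forall x, Omega x -> hull t x -> U x}].
Proof.
move=> oO; case: t => A B C; rewrite /Defs.nondegenerate/=.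
(* Scaling by the inverse determinant turns the three [edge_coord] functions into barycentric
   coordinates. *)
set d := (X in X != 0) => d0; pose D := d^-1.
have D0 : D != 0 by rewrite invr_eq0.
have AB : A <> B.
  by move=> h; move/eqP: d0; apply; rewrite /d h; ring.
have BC : B <> C.
  by move=> h; move/eqP: d0; apply; rewrite /d h; ring.
have CA : C <> A.
  by move=> h; move/eqP: d0; apply; rewrite /d h; ring.
exists (Omega `&` ([set x | 0 < edge_coord D B C x] `&`
  ([set x | 0 < edge_coord D C A x] `&` [set x | 0 < edge_coord D A B x]))); split.
- by do 3 (apply: openI => //; try exact: edge_coord_open).
- move=> x [Ox [/= ha [hb hc]]]; split=> //.
  exists (edge_coord D B C x), (edge_coord D C A x), (edge_coord D A B x).
  split; try exact: ltW.
    by rewrite /edge_coord /affine /D /d; field.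
  case: x {Ox ha hb hc} => x1 x2.
  apply/eqP; rewrite -pair_eqE /pair_eq /=; apply/andP; split; apply/eqP;
    by rewrite /edge_coord /affine /D /d /GRing.scale/=; field.
near=> x => Ox [a [b [c [a0 b0 c0 abc xE]]]].
have nA : edge_coord D B C x != 0.
  by near: x; exact: edge_coord_ae_neq0.
have nB : edge_coord D C A x != 0 by near: x; exact: edge_coord_ae_neq0.
have nC : edge_coord D A B x != 0 by near: x; exact: edge_coord_ae_neq0.
(* The weights of a convex combination are recovered as the values of [edge_coord], so they are
   nonzero as well. *)
have aE : a = 1 - b - c by rewrite -abc; ring.
have x1E : x.1 = a * A.1 + b * B.1 + c * C.1 by rewrite xE.
have x2E : x.2 = a * A.2 + b * B.2 + c * C.2 by rewrite xE.
have eA : edge_coord D B C x = a.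
  by rewrite /edge_coord /affine /D x1E x2E aE /d; field.
have eB : edge_coord D C A x = b.
  by rewrite /edge_coord /affine /D x1E x2E aE /d; field.
have eC : edge_coord D A B x = c.
  by rewrite /edge_coord /affine /D x1E x2E aE /d; field.
split=> //; split; last split; rewrite /= lt_neqAle eq_sym.
- by rewrite nA eA.
- by rewrite nB eB.
- by rewrite nC eC.
Unshelve. all: by end_near. Qed.

Lemma bisection_hull T T' : bisection T T' ->
  forall t', T' t' -> exists2 t : triangle R, T t & hull t' `<=` hull t.
Proof.
move=> [t Tt ->] t' [[Tt' _]|]; first by exists t'.
have mid (a b : R) : a *: midpoint t + b *: base1 t =
    (a / 2 + b) *: base1 t + (a / 2) *: base2 t.
  by rewrite /midpoint scalerA scalerDr scalerDl addrAC.
(* The weight [a] of the midpoint is shared equally by the two ends of the refinement edge. *)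
move=> [|] ->; exists t => // x [a [b [c [/= a0 b0 c0 abc ->]]]].
  exists b, (a / 2 + c), (a / 2); split; rewrite ?addr_ge0 ?divr_ge0//; first lra.
  by rewrite addrAC mid addrC addrA.
exists b, (a / 2), (a / 2 + c); split; rewrite ?addr_ge0 ?divr_ge0//; first lra.
by rewrite /midpoint scalerA scalerDr scalerDl addrAC addrC -!addrA.
Qed.

Lemma refinement_hull T T' : Relation_Operators.clos_refl_trans _ bisection T T' ->
  forall t', T' t' -> exists2 t : triangle R, T t & hull t' `<=` hull t.
Proof.
elim=> {T T'} [T T'|T t' Tt'|T T' T'' _ IH _ IH' t'' /IH'[t' /IH[t Tt tt'] t't'']].
- exact: bisection_hull.
- by exists t'.
- by exists t => //; exact: subset_trans tt'.
Qed.

End Hulls.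

(** * Partial derivatives of polynomials and their degree *)

Section PolynomialDerivatives.
Context {R : realType}.
Implicit Types (p : plane R -> R) (x v : plane R).

Lemma is_derive_bigsum (I : Type) (r : seq I) (P : pred I)
    (F : I -> plane R -> R) (dF : I -> R) v x :
  (forall i, is_derive x v (F i) (dF i)) ->
  is_derive x v (fun y => \sum_(i <- r | P i) F i y) (\sum_(i <- r | P i) dF i).
Proof.
move=> FdF; elim: r => [|i r IH].
  rewrite big_nil; under [X in is_derive _ _ X]funext do rewrite big_nil.
  exact: is_derive_cst.
rewrite big_cons; under [X in is_derive _ _ X]funext do rewrite big_cons.
by case: (P i) => //; exact: is_deriveD.
Qed.

Lemma is_derive_exprn (f : plane R -> R) v x df n : is_derive x v f df ->
  is_derive x v (fun y => f y ^+ n) (n%:R * f x ^+ n.-1 * df).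
Proof.
move=> fdf; elim: n => [|n IH].
  under [X in is_derive _ _ X]funext do rewrite expr0.
  by rewrite !mul0r; exact: is_derive_cst.
under [X in is_derive _ _ X]funext do rewrite exprS.
apply: (is_derive_eq (is_deriveM fdf IH)); rewrite /GRing.scale/=.
case: n {IH} => [|n]; rewrite /= ?expr0 ?exprS -?natr1; ring.
Qed.

Lemma is_derive_affine (a b c : R) x v :
  is_derive x v (affine a b c) (a * v.1 + b * v.2).
Proof.
have d := is_diff_affine a b c x.
have da : differentiable (affine a b c) x by have [] := d.
apply: DeriveDef; first exact: diff_derivable.
by rewrite deriveE//; have [_ ->] := d.
Qed.

Lemma is_derive_monomial (c : R) (i j : nat) x v :
  is_derive x v (fun y : plane R => c * y.1 ^+ i * y.2 ^+ j)
    (c * (i%:R * x.1 ^+ i.-1 * v.1 * x.2 ^+ j + x.1 ^+ i * (j%:R * x.2 ^+ j.-1 * v.2))).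
Proof.
have d1 : is_derive x v (fun y : plane R => y.1 : R) v.1.
  have := is_derive_affine 1 0 0 x v; rewrite mul1r mul0r addr0.
  by congr (is_derive _ _ _ _); apply/funext => y; rewrite /affine mul1r mul0r !addr0.
have d2 : is_derive x v (fun y : plane R => y.2 : R) v.2.
  have := is_derive_affine 0 1 0 x v; rewrite mul1r mul0r add0r.
  by congr (is_derive _ _ _ _); apply/funext => y; rewrite /affine mul1r mul0r add0r addr0.
have d := is_deriveM (is_deriveM (is_derive_cst c x v) (is_derive_exprn i d1))
  (is_derive_exprn j d2).
by apply: (is_derive_eq d); rewrite /GRing.scale/= !fctE; ring.
Qed.

Lemma poly_le_flat k p : poly_le k p -> flat_algebra p.
Proof.
have flat_sum (I : Type) (r : seq I) (P : pred I) (F : I -> plane R -> R) :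
    (forall i, flat_algebra (F i)) ->
    flat_algebra (fun x => \sum_(i <- r | P i) F i x).
  move=> FF; elim: r => [|i r IH].
    by under [X in flat_algebra X]funext do rewrite big_nil; exact: flat_cst.
  under [X in flat_algebra X]funext do rewrite big_cons.
  by case: (P i) => //; exact: flat_add.
have flat_pow (f : plane R -> R) n :
    flat_algebra f -> flat_algebra (fun x => f x ^+ n).
  move=> Ff; elim: n => [|n IH].
    by under [X in flat_algebra X]funext do rewrite expr0; exact: flat_cst.
  by under [X in flat_algebra X]funext do rewrite exprS; exact: flat_mul.
have f1 : flat_algebra (fun x : plane R => x.1 : R).
  suff <- : affine 1 0 0 = (fun x : plane R => x.1 : R) by exact: flat_affine.
  by apply/funext => y; rewrite /affine mul1r mul0r !addr0.
have f2 : flat_algebra (fun x : plane R => x.2 : R).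
  suff <- : affine 0 1 0 = (fun x : plane R => x.2 : R) by exact: flat_affine.
  by apply/funext => y; rewrite /affine mul1r mul0r add0r addr0.
move=> [c /funext ->]; apply: (flat_sum) => i; apply: (flat_sum) => j.
by apply: flat_mul; [apply: flat_mul; [exact: flat_cst|]|]; exact: flat_pow.
Qed.

Lemma poly_le_pderiv k i p : poly_le k.+1 p -> poly_le k (pderiv i p).
Proof.
move=> [c /funext ->].
have DE x : pderiv i (fun x : plane R => \sum_(a < k.+2)
    \sum_(b < k.+2 | (a + b <= k.+1)%N) c a b * x.1 ^+ a * x.2 ^+ b) x =
    \sum_(a < k.+2) \sum_(b < k.+2 | (a + b <= k.+1)%N)
      c a b * (a%:R * x.1 ^+ a.-1 * (basis_vec i).1 * x.2 ^+ b +
               x.1 ^+ a * (b%:R * x.2 ^+ b.-1 * (basis_vec i).2)).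
  rewrite /pderiv; apply: derive_val.
  apply: is_derive_bigsum => a; apply: is_derive_bigsum => b.
  exact: is_derive_monomial.
have : i = ord0 \/ i = ord_max.
  by case: i {DE} => -[|[|//]] ?; [left|right]; exact: val_inj.
move=> [i0|i1].
  (* The exponent [a] is shifted by one: the term [a = 0] has derivative zero, and after the shift
     [b = k.+1] exceeds the total degree. *)
  exists (fun a b => c a.+1 b * a.+1%:R) => x; rewrite DE i0 /basis_vec/=.
  rewrite big_ord_recl [X in X + _]big1 ?add0r => [|b _]; last first.
    by rewrite /=; ring.
  apply: eq_bigr => a _; rewrite big_mkcond big_ord_recr/= [RHS]big_mkcond/=.
  rewrite [X in _ + X]ifF ?addr0; last first.
    by apply/negbTE; rewrite -ltnNge /bump/= add1n addSn ltnS leq_addl.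
  apply: eq_bigr => b _; rewrite /bump/= add1n addSn ltnS.
  by case: ifP => // _; ring.
(* Here [b] is shifted: [a = k.+1] forces [b = 0], and all terms with [b = 0] have derivative
   zero. *)
exists (fun a b => c a b.+1 * b.+1%:R) => x; rewrite DE i1 /basis_vec/=.
rewrite big_ord_recr/= [X in _ + X]big1 ?addr0 => [|b]; last first.
  rewrite -[k.+1 in X in (_ <= X)%N]addn0 leq_add2l leqn0 => /eqP ->.
  by rewrite /=; ring.
apply: eq_bigr => a _; rewrite big_mkcond big_ord_recl/= [RHS]big_mkcond/=.
rewrite [X in X + _](_ : _ = 0) ?add0r; last by case: ifP => // _; ring.
apply: eq_bigr => b _; rewrite /bump/= add1n addnS ltnS.
by case: ifP => // _; ring.
Qed.

End PolynomialDerivatives.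

(** * The symmetric Curl of piecewise polynomials *)

Section SymCurl.
Context {R : realType}.
Variable Omega : set (plane R).
Implicit Types (T : set (triangle R)).
Local Notation mu := (mu2 R).

Lemma wpderivP i f : H1 Omega f ->
  L2 Omega (wpderiv Omega i f) /\ weak_pderiv Omega i f (wpderiv Omega i f).
Proof.
move=> [_ /(_ i)[g Lg fg]].
suff /(xgetPex (fun=> 0)) : exists g, [set g | L2 Omega g /\ weak_pderiv Omega i f g] g.
  by exact.
by exists g.
Qed.

(** Scalar counterpart of [Pk]: components of the Curl and of its symmetric part are linear
    combinations inside this subspace. *)
Definition pw_poly k T : set (plane R -> R) := [set f | L2 Omega f /\
  forall t, T t -> exists2 p, poly_le k p &
    {ae mu, forall x, Omega x -> hull t x -> f x = p x}].

Lemma is_subspace_pw_poly k T : is_subspace (pw_poly k T).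
Proof.
split.
  split; first exact: L2_cst0.
  by move=> t _; exists (fun=> 0); [exact: poly_le0|exact: aeW].
move=> a f g [Lf Pf] [Lg Pg]; split; first exact: (L2_linear a Lf Lg).
move=> t Tt; have [p p_le fp] := Pf t Tt; have [q q_le gq] := Pg t Tt.
exists (fun x => a * p x + q x); first exact: poly_le_linear.
apply: filterS2 fp gq => x fp gq Ox tx.
by rewrite -fp// -gq.
Qed.

(** On the open set filling a triangle up to a null set, the weak derivative is the classical one of
    the local polynomial. *)
Lemma pw_poly_wpderiv k T i f : open Omega -> (forall t, T t -> Defs.nondegenerate t) ->
  H1 Omega f -> pw_poly k.+1 T f -> pw_poly k T (wpderiv Omega i f).
Proof.
move=> oO nT Hf [Lf Pf]; have [Lg fg] := wpderivP i Hf; split => // t Tt.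
have [p p_le fp] := Pf t Tt; exists (pderiv i p); first exact: poly_le_pderiv.
have [U [oU UO tU]] := hull_ae_interior oO (nT t Tt).
have UOmega : U `<=` Omega by move=> x /UO[].
have fpU : {ae mu, forall x, U x -> f x = p x}.
  by apply: filterS fp => x fx /UO[Ox tx]; exact: fx.
have gp := weak_pderiv_ae_open Lf Lg fg (poly_le_flat p_le) oU UOmega fpU.
by apply: filterS2 gp tU => x gx Ux Ox tx; apply: gx; exact: Ux.
Qed.

(** Composition with [s] merely permutes the summands. *)
Lemma symmetric_sym l (B : tensor R l) : Defs.symmetric (sym B).
Proof.
move=> s j; rewrite !ffunE; congr (_ * _).
rewrite [RHS](reindex_inj (mulIg s))/=; apply: eq_bigr => s' _; congr (B _).
by apply/ffunP => i; rewrite !ffunE permM.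
Qed.

Lemma symCurl_Xh k l T (b : tfield R l) : open Omega ->
  (forall t, T t -> Defs.nondegenerate t) ->
  H1t Omega b -> Pk Omega k.+1 T b -> Xh Omega k T (symCurl Omega b).
Proof.
move=> oO nT Hb [Lb Pb]; split; last first.
  by apply: aeW => x _; exact: symmetric_sym.
have bj j : pw_poly k.+1 T (fun x => b x j) by split => // t Tt; exact: Pb.
have sV := is_subspace_pw_poly k T.
have Cj j : pw_poly k T (fun x => Curl Omega b x j).
  have wj i : pw_poly k T (wpderiv Omega i (fun y => b y (init_index j))).
    exact: pw_poly_wpderiv.
  have [j0|j0] := boolP (last_index j == ord0); last first.
    under [X in pw_poly _ _ X]funext do rewrite ffunE (negbTE j0).
    exact: wj.
  suff -> : (fun x => Curl Omega b x j) =
      (-1) *: wpderiv Omega ord_max (fun y => b y (init_index j)).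
    exact: subspaceZ.
  by apply/funext => x; rewrite ffunE j0 scaleN1r.
have sj j : pw_poly k T (fun x => symCurl Omega b x j).
  have -> : (fun x => symCurl Omega b x j) = ((l.+1)`!%:R)^-1 *:
      (\sum_(s : 'S_l.+1) (fun x => Curl Omega b x (perm_index s j))).
    by apply/funext => x; rewrite ffunE fctE fct_sumE.
  by apply: subspaceZ => //; apply: subspace_sum.
split=> [j|t Tt j]; first by have [] := sj j.
by have [_ /(_ t Tt)] := sj j.
Qed.

(** The common core of both claims: [symCurl Omega b] lies in [Xh], to which [f - p] is orthogonal,
    so [p] and [f] have the same product with it. *)
Lemma Wh_projection k l T (f : tfield R l.+1) : open Omega -> triangulation Omega T ->
  L2t Omega f ->
  (forall b, Yh Omega k T b -> L2dot Omega f (symCurl Omega b) = 0) ->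
  Wh Omega k T (L2proj Omega (Xh Omega k T) f).
Proof.
move=> oO [fT nT cT _] Lf f0.
have OT : Omega `<=` \bigcup_(t in T) hull t by rewrite cT; exact: subset_closure.
have [XP fP] := Xh_projection k fT OT Lf; split=> // b Yb.
have [Pb [[Hb _ _] _]] := Yb.
have Xb : Xh Omega k T (symCurl Omega b) by exact: symCurl_Xh.
have Lb : L2t Omega (symCurl Omega b) by have [[]] := Xb.
set p := L2proj _ _ _ in XP fP *.
have Lp : L2t Omega p by have [[]] := XP.
have -> : p = (-1) *: (fun x => f x - p x) + f.
  apply/funext => x; transitivity (- (f x - p x) + f x).
    by rewrite opprB subrK.
  by rewrite -scaleN1r.
rewrite L2dot_linear// ?fP// ?f0 ?mulr0 ?addr0//.
exact: (subspaceB (is_subspace_L2t Omega)).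
Qed.

Lemma Yh_refinement k l T T' (b : tfield R l) : admissible_refinement Omega T T' ->
  Yh Omega k T b -> Yh Omega k T' b.
Proof.
move=> [TT' _] [[Lb Pb] Yb]; split => //; split=> // t' T't' j.
have [t Tt tt'] := refinement_hull TT' T't'.
have [p p_le bp] := Pb t Tt j; exists p => //.
by apply: filterS bp => x bx Ox /tt'; exact: bx.
Qed.

End SymCurl.

(* The tensor order m >= 1 is written m'.+1. *)
Theorem lemma5p8 (R : realType) (Omega : set (plane R)) (m' k : nat)
    (T : set (triangle R)) (kappa : R) (tau : tfield R m'.+1) :
  polygonal_lipschitz_domain Omega ->
  triangulation Omega T ->
  shape_regular kappa T ->
  L2t Omega tau -> sym_valued Omega tau ->
  (forall beta : tfield R m',
     Yspace Omega beta -> L2dot Omega tau (symCurl Omega beta) = 0) ->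
  Wh Omega k T (L2proj Omega (Xh Omega k T) tau) /\
  (forall (Tstar : set (triangle R)) (taustar : tfield R m'.+1),
     admissible_refinement Omega T Tstar ->
     Wh Omega k Tstar taustar ->
     Wh Omega k T (L2proj Omega (Xh Omega k T) taustar)).
Proof.
move=> [[[oO _ _] _] _ _ _] trT _ Ltau _ tau0; split.
  by apply: Wh_projection => // b [_ Yb]; exact: tau0.
move=> T' tau' TT' [[[Ltau' _] _] tau'0]; apply: Wh_projection => // b Yb.
exact/tau'0/(Yh_refinement TT').
Qed.
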